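(* Let $\Gamma$ be a finite, simplicial, connected graph, let $A_\Gamma^\omega$ be an asymptotic cone of $A_\Gamma$, and fix a pair of points $\mathbf a,\mathbf b\in A_\Gamma^\omega$. The following are equivalent. (1) No point of $A_\Gamma^\omega$ separates $\mathbf a$ from $\mathbf b$. (2) There exist points $\mathbf a',\mathbf b'\in A_\Gamma^\omega$ arbitrarily close to $\mathbf a,\mathbf b$, respectively, for which the join length between $\mathbf a'$ and $\mathbf b'$ is finite. That is, for every $\epsilon>0$ there are $\mathbf a',\mathbf b'$ within distance $\epsilon$ of $\mathbf a$ and $\mathbf b$, respectively, such that the pair $\mathbf a',\mathbf b'$ has finite join length.
   Context: Right-angled Artin group: for a finite simplicial graph $\Gamma$ with vertex set $V$, $A_\Gamma=\langle V\mid vw=wv$ whenever $v,w$ are joined by an edge of $\Gamma\rangle$, with the metric of its Cayley graph with respect to $V$. Asymptotic cone: for a geodesic metric space $(X,d)$, a non-principal ultrafilter $\omega$, observation points $(o_n)$ in $X$ and scaling constants $(d_n)$ with $\lim_\omega d_n=\infty$, the asymptotic cone $X^\omega$ is the set of equivalence classes of sequences $(a_n)$ in $X$ with $\lim_\omega d(o_n,a_n)/d_n<\infty$, where $(a_n)$ and $(a_n')$ represent the same point if and only if $\lim_\omega d(a_n,a_n')/d_n=0$, with metric $d_\omega(\mathbf a,\mathbf b)=\lim_\omega d(a_n,b_n)/d_n$. Here $\omega,(o_n),(d_n)$ are fixed and $A_\Gamma^\omega$ denotes the resulting cone of $A_\Gamma$. A point $\mathbf c$ separates $\mathbf a$ from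 $\mathbf b$ if $\mathbf a,\mathbf b\neq\mathbf c$ lie in different components of $A_\Gamma^\omega\setminus\{\mathbf c\}$. Joins: the join of two non-empty graphs $\Gamma_1,\Gamma_2$ is the graph obtained by connecting every vertex of $\Gamma_1$ to every vertex of $\Gamma_2$ by an edge. If $J$ is a full (induced) subgraph of $\Gamma$ which decomposes as a join of two non-empty graphs, the subgroup $A_J\subseteq A_\Gamma$ generated by the vertices of $J$ is called a join subgroup. For $g\in A_\Gamma$, the join length is $\ell_J(g)=\min\{k\mid g=a_1\cdots a_k$ with each $a_i$ in a join subgroup of $A_\Gamma\}$ (it is $\infty$ if there is no such expression; the identity is the empty product). Finite join length in the cone: a pair $\mathbf a,\mathbf b\in A_\Gamma^\omega$ has finite join length if there exist representative sequences $(a_n),(b_n)$ in $A_\Gamma$ of $\mathbf a,\mathbf b$ for which $\lim_\omega \ell_J(a_n^{-1}b_n)<\infty$. *)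

(* Defs.v *)
From HB Require Import structures.
From mathcomp Require Import all_boot all_order all_algebra generic_quotient.
From mathcomp Require Import all_classical all_reals all_analysis.

Set Implicit Arguments.
Unset Strict Implicit.
Unset Printing Implicit Defensive.

Import Order.TTheory GRing.Theory Num.Theory.
Import numFieldNormedType.Exports.

Local Open Scope classical_set_scope.
Local Open Scope ring_scope.
Local Open Scope quotient_scope.

Section Ultralimits.
Context {R : realType} (w : set_system nat) {wU : UltraFilter w}.

Lemma fmap_ultra (T : Type) (u : nat -> T) : UltraFilter (u @ w).
Proof.
split=> [|G GF sG]; first exact: fmap_proper_filter.
apply/seteqP; split => // A GA.
have [//|nA] := in_ultra_setVsetC (u @^-1` A) wU.
have GnA : G (~` A) by exact: sG.
have GI : G (A `&` ~` A) by exact: filterI.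
by have [x []] := filter_ex GI.
Qed.

Lemma ultra_bounded_cvg (u : nat -> R) (M : R) :
  w [set n | `|u n| <= M] -> cvg (u @ w).
Proof.
move=> uM; have := @segment_compact R (- M) M.
rewrite compact_ultra => /(_ _ (fmap_ultra u)) [|l [_ ul]].
  suff : w [set n | u n \in `[- M, M]] by [].
  by apply: filterS uM => n /=; rewrite in_itv/= ler_norml.
by apply/cvg_ex; exists l.
Qed.

Lemma ultra_lim_ltey_bounded (u : nat -> \bar R) :
  (lim (u n @[n --> w]) < +oo)%E -> exists M : R, w [set n | (u n <= M%:E)%E].
Proof.
move=> ul; apply: contrapT => /forallNP uM; move: ul.
have /cvg_lim -> // : u n @[n --> w] --> +oo%E.
apply/cvgeyPge => M.
have [/uM//|] := in_ultra_setVsetC [set n | (u n <= M%:E)%E] wU.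
by apply: filterS => n /= /negP; rewrite -ltNge => /ltW.
Qed.

End Ultralimits.

Record cone_data (R : realType) (X : Type) := ConeData {
  cone_filter : set_system nat;
  cone_filter_ultra : UltraFilter cone_filter;
  cone_filter_nonprincipal : forall n, ~ cone_filter [set n];
  observation : nat -> X;
  scaling : nat -> R;
  scaling_infty : scaling n @[n --> cone_filter] --> +oo }.

#[global] Existing Instance cone_filter_ultra.

Section AsymptoticCone.
Context {R : realType} {X : metricType R} (D : cone_data R X).
Local Notation w := (cone_filter D).

Definition scaled_dist (a b : nat -> X) (n : nat) : R :=
  mdist (a n) (b n) / scaling D n.

(* Limits along an ultrafilter always exist in \bar R, so the inequality is a
   genuine finiteness condition. *)
Definition admissible (a : nat -> X) : Prop :=
  (lim ((scaled_dist (observation D) a n)%:E @[n --> w]) < +oo)%E.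

Definition admissible_seq := {a : nat -> X | admissible a}.
HB.instance Definition _ := gen_eqMixin admissible_seq.
HB.instance Definition _ := gen_choiceMixin admissible_seq.

Definition lim_dist (a b : nat -> X) : R := lim (scaled_dist a b @ w).

Lemma scaling_gt0 : \forall n \near w, 0 < scaling D n.
Proof. by have /cvgryPgt := @scaling_infty _ _ D; exact. Qed.

Lemma scaled_dist_ge0 a b : \forall n \near w, 0 <= scaled_dist a b n.
Proof.
by apply: filterS scaling_gt0 => n s0; rewrite divr_ge0 ?mdist_ge0 ?ltW.
Qed.

Lemma scaled_dist_triangle b a c :
  \forall n \near w, scaled_dist a c n <= scaled_dist a b n + scaled_dist b c n.
Proof.
apply: filterS scaling_gt0 => n s0.
by rewrite -mulrDl ler_pM2r ?invr_gt0// metric_triangle.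
Qed.

Lemma scaled_dist_sym a b : scaled_dist a b = scaled_dist b a.
Proof. by apply/funext => n; rewrite /scaled_dist metric_sym. Qed.

Lemma cvg_scaled_dist a b : admissible a -> admissible b ->
  cvg (scaled_dist a b @ w).
Proof.
move=> /ultra_lim_ltey_bounded[M aM] /ultra_lim_ltey_bounded[N bN].
apply: (@ultra_bounded_cvg _ _ _ _ (M + N)); rewrite /=.
apply: (filterS _ (filterI (filterI aM bN) (filterI (scaled_dist_ge0 a b)
  (scaled_dist_triangle (observation D) a b)))) => n [[/= an bn] [ab0 abn]].
rewrite ger0_norm// (le_trans abn)// scaled_dist_sym lerD//.
Qed.

Lemma lim_distxx a : lim_dist a a = 0.
Proof.
rewrite /lim_dist (_ : scaled_dist a a = cst 0) ?(lim_cst (@norm_hausdorff _ _))//.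
by apply/funext => n; rewrite /scaled_dist mdistxx mul0r.
Qed.

Lemma lim_dist_sym a b : lim_dist a b = lim_dist b a.
Proof. by rewrite /lim_dist scaled_dist_sym. Qed.

Lemma lim_dist_ge0 a b : admissible a -> admissible b -> 0 <= lim_dist a b.
Proof.
move=> ha hb; apply: limr_ge; first exact: cvg_scaled_dist.
exact: scaled_dist_ge0.
Qed.

Lemma lim_dist_triangle b a c :
  admissible a -> admissible b -> admissible c ->
  lim_dist a c <= lim_dist a b + lim_dist b c.
Proof.
move=> ha hb hc; rewrite /lim_dist -limD; do ?exact: cvg_scaled_dist.
apply: ler_lim; first exact: cvg_scaled_dist.
  by apply: is_cvgD; exact: cvg_scaled_dist.
exact: scaled_dist_triangle.
Qed.

Definition cone_rel (a b : admissible_seq) : bool :=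
  `[< lim_dist (sval a) (sval b) = 0 >].

Lemma cone_rel_refl : reflexive cone_rel.
Proof. by move=> a; apply/asboolP; exact: lim_distxx. Qed.

Lemma cone_rel_sym : symmetric cone_rel.
Proof. by move=> a b; rewrite /cone_rel lim_dist_sym. Qed.

Lemma cone_rel_trans : transitive cone_rel.
Proof.
move=> [b hb] [a ha] [c hc] /asboolP/= ab /asboolP/= bc; apply/asboolP/le_anti.
rewrite lim_dist_ge0//= andbT.
by rewrite (le_trans (lim_dist_triangle ha hb hc))// ab bc addr0.
Qed.

Canonical cone_equiv :=
  EquivRel cone_rel cone_rel_refl cone_rel_sym cone_rel_trans.

Definition acone := {eq_quot cone_equiv}.
HB.instance Definition _ := Choice.on acone.
HB.instance Definition _ := EqQuotient.on acone.

Definition cone_point (a : admissible_seq) : acone := \pi_acone a.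

Definition cone_dist (a b : acone) : R :=
  lim_dist (sval (repr a)) (sval (repr b)).

Lemma cone_pointP (a b : admissible_seq) :
  cone_point a = cone_point b <-> lim_dist (sval a) (sval b) = 0.
Proof.
rewrite /cone_point; split=> [/eqmodP/asboolP//|ab].
exact/eqmodP/asboolP.
Qed.

Lemma cone_pointK (a : acone) : cone_point (repr a) = a.
Proof. exact: reprK. Qed.

Lemma cone_distE (a b : admissible_seq) :
  cone_dist (cone_point a) (cone_point b) = lim_dist (sval a) (sval b).
Proof.
have ra := (cone_pointP _ _).1 (cone_pointK (cone_point a)).
have rb := (cone_pointP _ _).1 (cone_pointK (cone_point b)).
rewrite /cone_dist; move: ra rb.
case: (repr _) => a' ha'; case: (repr _) => b' hb'.
case: a b => [a ha] [b hb] /= ra rb.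
have ra' : lim_dist a a' = 0 by rewrite lim_dist_sym.
have rb' : lim_dist b b' = 0 by rewrite lim_dist_sym.
apply/le_anti/andP; split.
  rewrite (le_trans (lim_dist_triangle ha' ha hb'))// ra add0r.
  by rewrite (le_trans (lim_dist_triangle ha hb hb'))// rb' addr0.
rewrite (le_trans (lim_dist_triangle ha ha' hb))// ra' add0r.
by rewrite (le_trans (lim_dist_triangle ha' hb' hb))// rb addr0.
Qed.

Lemma cone_distxx a : cone_dist a a = 0.
Proof. exact: lim_distxx. Qed.

Lemma cone_dist_positivity a b : cone_dist a b = 0 -> a = b.
Proof. by move=> /cone_pointP; rewrite !cone_pointK. Qed.

Lemma cone_dist_sym a b : cone_dist a b = cone_dist b a.
Proof. exact: lim_dist_sym. Qed.

Lemma cone_dist_triangle b a c : cone_dist a c <= cone_dist a b + cone_dist b c.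
Proof. by apply: lim_dist_triangle; exact: svalP. Qed.

HB.instance Definition _ := isMetric.Build R acone
  cone_distxx cone_dist_positivity cone_dist_sym cone_dist_triangle.

End AsymptoticCone.

Definition separates (T : topologicalType) (c a b : T) : Prop :=
  [/\ a <> c, b <> c &
      connected_component (~` [set c]) a <> connected_component (~` [set c]) b].

Record sgraph := SGraph {
  vertex :> finType;
  edge : rel vertex;
  edge_sym : symmetric edge;
  edge_irr : irreflexive edge }.

Definition connected_graph (G : sgraph) : Prop :=
  forall v v' : G, connect (@edge G) v v'.

Section RAAG.
Variable G : sgraph.

(* The letter (v, true) stands for v and (v, false) for its inverse. *)
Definition word := seq (G * bool).

Inductive raag_eq : word -> word -> Prop :=
| raag_refl s : raag_eq s s
| raag_sym s t : raag_eq s t -> raag_eq t s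
| raag_trans s t u : raag_eq s t -> raag_eq t u -> raag_eq s u
| raag_cancel p q v b : raag_eq (p ++ (v, b) :: (v, ~~ b) :: q) (p ++ q)
| raag_commute p q v v' : edge v v' ->
    raag_eq (p ++ (v, true) :: (v', true) :: q)
            (p ++ (v', true) :: (v, true) :: q).

Definition raag_rel (s t : word) : bool := `[< raag_eq s t >].

Lemma raag_rel_refl : reflexive raag_rel.
Proof. by move=> s; apply/asboolP; exact: raag_refl. Qed.

Lemma raag_rel_sym : symmetric raag_rel.
Proof. by move=> s t; apply/asboolP/asboolP; exact: raag_sym. Qed.

Lemma raag_rel_trans : transitive raag_rel.
Proof.
by move=> t s u /asboolP st /asboolP tu; apply/asboolP; exact: raag_trans tu.
Qed.

Canonical raag_equiv :=
  EquivRel raag_rel raag_rel_refl raag_rel_sym raag_rel_trans.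

Definition raag := {eq_quot raag_equiv}.
HB.instance Definition _ := Choice.on raag.
HB.instance Definition _ := EqQuotient.on raag.

Definition raag_word (s : word) : raag := \pi_raag s.

Lemma raag_wordP s t : raag_word s = raag_word t <-> raag_eq s t.
Proof.
rewrite /raag_word; split=> [/eqmodP/asboolP//|st].
exact/eqmodP/asboolP.
Qed.

Lemma raag_wordK (g : raag) : raag_word (repr g) = g.
Proof. exact: reprK. Qed.

Lemma raag_eq_cat_ctx p q s t :
  raag_eq s t -> raag_eq (p ++ s ++ q) (p ++ t ++ q).
Proof.
elim=> {s t} [s|s t _|s t u _ st _ tu|p' q' v b|p' q' v v' vv'].
- exact: raag_refl.
- exact: raag_sym.
- exact: raag_trans tu.
- by rewrite -!catA /= !(catA p p'); exact: raag_cancel.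
- by rewrite -!catA /= !(catA p p'); exact: raag_commute.
Qed.

Lemma raag_eq_cat s s' t t' :
  raag_eq s s' -> raag_eq t t' -> raag_eq (s ++ t) (s' ++ t').
Proof.
move=> ss tt; apply: raag_trans (raag_eq_cat_ctx [::] t ss) _ => /=.
by have := raag_eq_cat_ctx s' [::] tt; rewrite !cats0.
Qed.

Definition word_inv (s : word) : word := rev [seq (x.1, ~~ x.2) | x <- s].

Lemma word_invK : involutive word_inv.
Proof.
move=> s; rewrite /word_inv map_rev revK -map_comp map_id_in// => -[v b] _ /=.
by rewrite negbK.
Qed.

Lemma raag_eq_mulV s : raag_eq (s ++ word_inv s) [::].
Proof.
elim: s => [|[v b] s IHs]; first exact: raag_refl.
rewrite /word_inv /= rev_cons -cats1 catA.
apply: raag_trans (raag_eq_cat_ctx [:: (v, b)] [:: (v, ~~ b)] IHs) _.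
exact: (raag_cancel [::] [::]).
Qed.

Lemma raag_eq_Vmul s : raag_eq (word_inv s ++ s) [::].
Proof. by have := raag_eq_mulV (word_inv s); rewrite word_invK. Qed.

Lemma raag_eq_inv s t : raag_eq s t -> raag_eq (word_inv s) (word_inv t).
Proof.
move=> st; rewrite -[word_inv s]cats0 -[X in raag_eq _ X]cat0s.
apply: raag_trans (raag_eq_cat (raag_refl _) (raag_sym (raag_eq_mulV t))) _.
rewrite catA; apply: raag_eq_cat (raag_refl _).
apply: raag_trans (raag_eq_Vmul s).
exact: raag_eq_cat (raag_refl _) (raag_sym st).
Qed.

Definition raag_one : raag := raag_word [::].
Definition raag_mul (g h : raag) : raag := raag_word (repr g ++ repr h).
Definition raag_inv (g : raag) : raag := raag_word (word_inv (repr g)).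

Lemma repr_raag_word s : raag_eq (repr (raag_word s)) s.
Proof. exact/raag_wordP/raag_wordK. Qed.

Lemma raag_mul_word s t :
  raag_mul (raag_word s) (raag_word t) = raag_word (s ++ t).
Proof. by apply/raag_wordP/raag_eq_cat; exact: repr_raag_word. Qed.

Lemma raag_inv_word s : raag_inv (raag_word s) = raag_word (word_inv s).
Proof. by apply/raag_wordP/raag_eq_inv; exact: repr_raag_word. Qed.

Lemma raag_mulA : associative raag_mul.
Proof.
move=> g h k; rewrite -[g]raag_wordK -[h]raag_wordK -[k]raag_wordK.
by rewrite !raag_mul_word catA.
Qed.

Lemma raag_mul1g : left_id raag_one raag_mul.
Proof. by move=> g; rewrite -[g]raag_wordK raag_mul_word. Qed.

Lemma raag_mulg1 : right_id raag_one raag_mul.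
Proof. by move=> g; rewrite -[g]raag_wordK raag_mul_word cats0. Qed.

Lemma raag_mulVg : left_inverse raag_one raag_inv raag_mul.
Proof.
move=> g; rewrite -[g]raag_wordK raag_inv_word raag_mul_word.
exact/raag_wordP/raag_eq_Vmul.
Qed.

Lemma raag_mulgV : right_inverse raag_one raag_inv raag_mul.
Proof.
move=> g; rewrite -[g]raag_wordK raag_inv_word raag_mul_word.
exact/raag_wordP/raag_eq_mulV.
Qed.

HB.instance Definition _ := isGroup.Build raag
  raag_mulA raag_mul1g raag_mulg1 raag_mulVg raag_mulgV.

Definition gen (v : G) : raag := raag_word [:: (v, true)].

Definition cayley_adj (g h : raag) : bool :=
  [exists v : G, (h == g * gen v)%g || (g == h * gen v)%g].

Definition cayley_path_of_size (g h : raag) (n : nat) : Prop :=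
  exists p : seq raag, [/\ path cayley_adj g p, last g p = h & size p = n].

Lemma cayley_adj_sym : symmetric cayley_adj.
Proof. by move=> g h; apply: eq_existsb => v; rewrite orbC. Qed.

Lemma cayley_path_sym g h n :
  cayley_path_of_size g h n -> cayley_path_of_size h g n.
Proof.
move=> [p [gp <- <-]]; exists (rev (belast g p)); split.
- by rewrite rev_path (eq_path (e' := cayley_adj))// => x y; exact: cayley_adj_sym.
- by case: p {gp} => //= x p; rewrite rev_cons last_rcons.
- by rewrite size_rev size_belast.
Qed.

Lemma cayley_path_trans h g k m n : cayley_path_of_size g h m ->
  cayley_path_of_size h k n -> cayley_path_of_size g k (m + n).
Proof.
move=> [p [gp pe <-]] [q [hq qe <-]]; exists (p ++ q).
by rewrite cat_path last_cat size_cat pe gp hq.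
Qed.

Lemma cayley_path_exists (g h : raag) : exists n, `[< cayley_path_of_size g h n >].
Proof.
suff H s k : exists n, cayley_path_of_size k (k * raag_word s)%g n.
  have [n Hn] := H (repr (g^-1 * h)%g) g; exists n; apply/asboolP.
  by rewrite raag_wordK mulgA mulgV mul1g in Hn.
elim: s k => [|[v b] s IHs] k; first by exists 0%N, [::]; rewrite mulg1.
have [n] := IHs (k * raag_word [:: (v, b)])%g.
rewrite -mulgA [(raag_word [:: (v, b)] * _)%g]raag_mul_word => Hn.
exists (1 + n)%N; apply: cayley_path_trans Hn.
exists [:: (k * raag_word [:: (v, b)])%g]; split => //=; rewrite andbT.
apply/existsP; exists v; case: b => /=; first by rewrite eqxx.
rewrite -mulgA [(raag_word [:: (v, false)] * _)%g]raag_mul_word.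
have -> : raag_word ([:: (v, false)] ++ [:: (v, true)]) = 1%g.
  by apply/raag_wordP; exact: (raag_cancel [::] [::]).
by rewrite mulg1 eqxx orbT.
Qed.

Definition cayley_dist (g h : raag) : nat := ex_minn (cayley_path_exists g h).

Lemma cayley_distP g h : cayley_path_of_size g h (cayley_dist g h).
Proof. by rewrite /cayley_dist; case: ex_minnP => n /asboolP. Qed.

Lemma cayley_dist_le g h n :
  cayley_path_of_size g h n -> (cayley_dist g h <= n)%N.
Proof.
by rewrite /cayley_dist; case: ex_minnP => m _ + H; apply; exact/asboolP.
Qed.

Lemma cayley_distxx g : cayley_dist g g = 0%N.
Proof. by apply/eqP; rewrite -leqn0; apply: cayley_dist_le; exists [::]. Qed.

Lemma cayley_dist_eq0 g h : cayley_dist g h = 0%N -> g = h.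
Proof.
by move=> gh; have := cayley_distP g h; rewrite gh => -[p [_ <- /size0nil ->]].
Qed.

Lemma cayley_dist_sym g h : cayley_dist g h = cayley_dist h g.
Proof.
by apply/eqP; rewrite eqn_leq !cayley_dist_le//;
  apply/cayley_path_sym/cayley_distP.
Qed.

Lemma cayley_dist_triangle h g k :
  (cayley_dist g k <= cayley_dist g h + cayley_dist h k)%N.
Proof. by apply/cayley_dist_le/cayley_path_trans; exact: cayley_distP. Qed.

Definition is_join (J : {set G}) : Prop :=
  exists J1 J2 : {set G},
    [/\ J1 != finset.set0, J2 != finset.set0, (J1 :&: J2)%SET = finset.set0,
        J = (J1 :|: J2)%SET &
        forall v v', v \in J1 -> v' \in J2 -> edge v v'].

Definition is_subgroup (H : set raag) : Prop :=
  [/\ H 1%g, forall g h, H g -> H h -> H (g * h)%g & forall g, H g -> H g^-1%g].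

Definition subgroup_of_vertices (J : {set G}) : set raag :=
  smallest is_subgroup [set gen v | v in [set` J]].

Definition in_join_subgroup (g : raag) : Prop :=
  exists2 J : {set G}, is_join J & subgroup_of_vertices J g.

Definition join_expressible (g : raag) (k : nat) : Prop :=
  exists s : seq raag, [/\ size s = k,
    forall a, a \in s -> in_join_subgroup a & g = (\prod_(a <- s) a)%g].

(* The infimum of the empty set is +oo. *)
Definition join_length (R : realType) (g : raag) : \bar R :=
  ereal_inf [set k%:R%:E | k in join_expressible g].

End RAAG.

Arguments join_length {G} R g.

(* A_G as the vertex set of its Cayley graph. Every point of the geometric
   realization is at distance at most 1/2 from a vertex, so both have the same
   asymptotic cones. The realType R is a parameter because the distance takes
   its values in R. *)
Definition cayley (R : realType) (G : sgraph) : Type := raag G.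
HB.instance Definition _ R G := Choice.copy (cayley R G) (raag G).

Section CayleyMetric.
Context (R : realType) (G : sgraph).

Let dist (g h : cayley R G) : R := (cayley_dist g h)%:R.

Let distxx g : dist g g = 0.
Proof. by rewrite /dist cayley_distxx. Qed.

Let dist_positivity g h : dist g h = 0 -> g = h.
Proof. by move/eqP; rewrite pnatr_eq0 => /eqP/cayley_dist_eq0. Qed.

Let dist_sym g h : dist g h = dist h g.
Proof. by rewrite /dist cayley_dist_sym. Qed.

Let dist_triangle h g k : dist g k <= dist g h + dist h k.
Proof. by rewrite /dist -natrD ler_nat cayley_dist_triangle. Qed.

HB.instance Definition _ := isMetric.Build R (cayley R G)
  distxx dist_positivity dist_sym dist_triangle.

End CayleyMetric.

Definition finite_join_length (R : realType) (G : sgraph)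
    (D : cone_data R (cayley R G)) (a b : acone D) : Prop :=
  exists an bn : admissible_seq D, [/\ cone_point an = a, cone_point bn = b &
    (lim (join_length R ((sval an n : raag G)^-1 * (sval bn n : raag G))%g
       @[n --> cone_filter D]) < +oo)%E].

(* Main.v *)
Require Import Defs.
From mathcomp Require Import all_boot all_order all_algebra.
From mathcomp Require Import all_classical all_reals all_analysis.
From mathcomp Require Import zify lra.

(** The proof detects cut points of the cone by walls of the Cayley graph.  The
    wall of an edge from g to gv consists of the edges from h to hv for which
    g^-1 h lies in the subgroup generated by the link of v.  A word is geodesic
    if and only if it crosses no wall twice ([uniq_geodesic], [geodesic_uniq]);
    hence the walls that separate two elements are those crossed by a geodesic
    between them, and two walls that cross share a square ([cross_square]).

    Assume that a and b have no approximations of finite join length.  Take a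
    geodesic from a_n to b_n and remove pieces of length eps d_n at both ends.
    The join length of the remaining word is unbounded, so the word has more and
    more edges such that the part between two consecutive ones is not a product
    of three elements of join subgroups ([greedy]).  As the star of a vertex with
    a neighbour is a join, the walls of two consecutive edges do not cross, and
    no wall crosses both of them.  Therefore every path from one of these walls
    to the next passes the geodesic closely, or is as long as the detour through
    it ([separated_dist]).  By the pigeonhole principle, m_n such edges lie within
    a distance o(d_n) of one point c_n of the geodesic, where m_n tends to
    infinity ([barrier_exists], [near_diagonal]).  Away from the limit c of c_n,
    nearby points of the cone differ by at most one step in the walls that have
    been passed.  Thus the points which have passed only boundedly many of them form an
    open and closed subset of the complement of c, and c separates a from b
    ([barrier_separates]).

    Conversely, the limit of a coset of a join subgroup is a product of two
    connected spaces with more than one point, and no point c cuts it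
    ([join_joined]).  If two such cosets meet in c, then one can walk around c
    along rays in the directions of the vertices of a path in the graph, because
    consecutive rays lie in a common coset of a join subgroup; this uses that the
    graph is connected ([wedge_joined]).  So a pair of finite join length is not
    separated by any point: a product of k elements of join subgroups can be
    reduced to a geodesic without leaving these subgroups, and then gives a chain
    of k cosets ([join_expressible_words], [chain_joined]).  Finally, a point
    closer to a than c is joined to a by a geodesic that misses c
    ([close_joined]), so approximations are enough. *)

Set Implicit Arguments.
Unset Strict Implicit.
Unset Printing Implicit Defensive.

Import Order.TTheory GRing.Theory Num.Theory.
Import numFieldNormedType.Exports.

(** * Words, special subgroups and the word metric *)

Section Words.
Variable G : sgraph.
Local Open Scope group_scope.
Implicit Types (s t p q r : word G) (g h k d : raag G) (x y z : G * bool)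
  (u v : G) (T : pred G).

Lemma raag_word_cat s t : raag_word (s ++ t) = raag_word s * raag_word t.
Proof. exact/esym/raag_mul_word. Qed.

Lemma raag_word_nil : raag_word [::] = 1 :> raag G.
Proof. by []. Qed.

Lemma raag_word_cons x s : raag_word (x :: s) = raag_word [:: x] * raag_word s.
Proof. exact: (raag_word_cat [:: x]). Qed.

Lemma raag_word_inv s : raag_word (word_inv s) = (raag_word s)^-1.
Proof. exact/esym/raag_inv_word. Qed.

Lemma raag_word_letterV v e : raag_word [:: (v, ~~ e)] = (raag_word [:: (v, e)])^-1.
Proof. by rewrite -raag_word_inv. Qed.

Lemma edge_commute u v e e' : edge u v ->
  commute (raag_word [:: (u, e)]) (raag_word [:: (v, e')]).
Proof.
move=> uv; have c : commute (gen u) (gen v).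
  by rewrite /commute /gen -!raag_word_cat; apply/raag_wordP/(raag_commute [::] [::]).
have gV (w : G) : raag_word [:: (w, false)] = (gen w)^-1 by exact: (raag_word_letterV w true).
case: e e' => -[]; rewrite ?gV -?[raag_word [:: (_, true)]]/(gen _) //.
- exact: commuteV.
- exact/commute_sym/commuteV/commute_sym.
- exact/commuteV/commute_sym/commuteV/commute_sym.
Qed.

(** Killing the generators outside [T] respects the defining relations, since each
    relator is then killed, kept or made trivial: this is the retraction of the
    group onto its special subgroup, on the level of words. *)
Lemma raag_eq_filter T s t : raag_eq s t ->
  raag_eq [seq x <- s | T x.1] [seq x <- t | T x.1].
Proof.
elim=> {s t} [s|s t _|s t r _ st _|p q v e|p q u v uv].
- exact: raag_refl.
- exact: raag_sym.
- exact: raag_trans.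
- rewrite !filter_cat /=; case: (T v); first exact: raag_cancel.
  exact: raag_refl.
- rewrite !filter_cat /=; case: (T u); case: (T v); try exact: raag_refl.
  exact: raag_commute.
Qed.

Definition special T g := exists2 s, all (fun x => T x.1) s & g = raag_word s.

Lemma special1 T : special T 1.
Proof. by exists [::]. Qed.

Lemma specialM T g h : special T g -> special T h -> special T (g * h).
Proof.
move=> [s Ts ->] [t Tt ->]; exists (s ++ t); first by rewrite all_cat Ts.
by rewrite raag_word_cat.
Qed.

Lemma specialV T g : special T g -> special T g^-1.
Proof.
move=> [s Ts ->]; exists (word_inv s); last by rewrite raag_word_inv.
by rewrite /word_inv all_rev all_map.
Qed.

Lemma special_sub (T T' : pred G) g : (forall v, T v -> T' v) -> special T g -> special T' g.
Proof. by move=> TT [s Ts ->]; exists s => //; apply: sub_all Ts => x; exact: TT. Qed.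

Lemma special_filter T s : special T (raag_word s) ->
  raag_word s = raag_word [seq x <- s | T x.1].
Proof.
move=> [t Tt /raag_wordP st]; apply/raag_wordP/(raag_trans st).
have -> : t = [seq x <- t | T x.1] by rewrite (all_filterP Tt).
exact/raag_eq_filter/raag_sym.
Qed.

Lemma special_commute T T' g h : (forall u v, T u -> T' v -> edge u v) ->
  special T g -> special T' h -> commute g h.
Proof.
move=> TT' [s Ts ->] [t Tt ->]; elim: s Ts => [|[u e] s IHs] /=.
  by move=> _; rewrite raag_word_nil; apply/commute_sym/commute1.
case/andP=> Tu Ts; rewrite raag_word_cons.
apply/commute_sym/commuteM; last exact/commute_sym/IHs.
elim: t Tt {IHs Ts} => [|[v e'] t IHt] /=.
  by move=> _; rewrite raag_word_nil; apply/commute_sym/commute1.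
case/andP=> Tv Tt; rewrite raag_word_cons.
apply/commute_sym/commuteM; last exact/commute_sym/IHt.
exact/edge_commute/TT'.
Qed.

Lemma subgroup_of_verticesP (J : {set G}) g :
  subgroup_of_vertices J g <-> special (mem J) g.
Proof.
split.
  apply; split; last by move=> _ [v Jv <-]; exists [:: (v, true)]; rewrite /= ?andbT.
  by split; [exact: special1|exact: specialM|exact: specialV].
move=> [s Js ->] H [[H1 HM HV] JH].
elim: s Js => [|[v e] s IHs] //= /andP[Jv Js].
rewrite raag_word_cons; apply: HM; last exact: IHs.
have Hv : H (gen v) by apply: JH; exists v.
by case: e => //; rewrite (raag_word_letterV v true); apply: HV.
Qed.

Definition geodesic s := forall t, raag_eq s t -> (size s <= size t)%N.

Lemma cayley_dist_le_size g s : (cayley_dist g (g * raag_word s)%g <= size s)%N.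
Proof.
apply: cayley_dist_le; elim: s g => [|[v b] s IHs] k; first by exists [::]; rewrite mulg1.
have := IHs (k * raag_word [:: (v, b)]); rewrite -mulgA -raag_word_cons => Hn.
rewrite -[size _]add1n; apply: cayley_path_trans Hn.
exists [:: k * raag_word [:: (v, b)]]; split => //=; rewrite andbT.
apply/existsP; exists v; case: b => /=; first by rewrite eqxx.
by rewrite (raag_word_letterV v true) mulgVK eqxx orbT.
Qed.

Lemma cayley_path_word g h n : cayley_path_of_size g h n ->
  exists2 s, h = g * raag_word s & size s = n.
Proof.
move=> [p []]; elim: p g n => [|k p IHp] g n /=.
  by move=> _ -> <-; exists [::]; rewrite ?mulg1.
case/andP=> /existsP[v gk] kp ph <-; have [s -> ss] := IHp _ _ kp ph erefl.
case/orP: gk => /eqP ->; last exists ((v, false) :: s); rewrite /= ?ss //.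
  by exists ((v, true) :: s); rewrite /= ?ss // raag_word_cons mulgA.
by rewrite raag_word_cons mulgA (raag_word_letterV v true) mulgK.
Qed.

Lemma cayley_distM k g h : cayley_dist (k * g) (k * h) = cayley_dist g h.
Proof.
suff H k' g' h' : (cayley_dist (k' * g')%g (k' * h')%g <= cayley_dist g' h')%N.
  apply/eqP; rewrite eqn_leq H /=.
  by rewrite -{1}(mulKg k g) -{1}(mulKg k h); exact: H.
have [s -> <-] := cayley_path_word (cayley_distP g' h').
by rewrite mulgA; exact: cayley_dist_le_size.
Qed.

Lemma geodesic_exists g h : exists s,
  [/\ h = g * raag_word s, size s = cayley_dist g h & geodesic s].
Proof.
have [s hE ss] := cayley_path_word (cayley_distP g h).
exists s; split => // t /raag_wordP st; rewrite ss hE st; exact: cayley_dist_le_size.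
Qed.

Lemma geodesic_dist g s : geodesic s -> cayley_dist g (g * raag_word s) = size s.
Proof.
move=> gs; apply/eqP; rewrite eqn_leq cayley_dist_le_size /=.
have [t [/mulgI/raag_wordP st <- _]] := geodesic_exists g (g * raag_word s).
exact: gs.
Qed.

Lemma special_geodesic T g h : special T (g^-1 * h) -> exists s,
  [/\ h = g * raag_word s, size s = cayley_dist g h, geodesic s & all (fun x => T x.1) s].
Proof.
have [s [-> ss gs]] := geodesic_exists g h; rewrite mulKg => /special_filter sE.
exists [seq x <- s | T x.1]; rewrite -sE; split => //; last exact: filter_all.
  apply/eqP; rewrite eqn_leq (geodesic_dist _ gs) size_filter count_size /=.
  by rewrite -size_filter; apply/gs/raag_wordP.
move=> t /raag_wordP; rewrite -sE => /raag_wordP/gs; apply: leq_trans.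
by rewrite size_filter count_size.
Qed.

(** The retraction onto the second special subgroup does not lengthen words and
    kills the other two factors. *)
Lemma retraction_dist T T' g h k : (forall v, T v -> ~~ T' v) ->
  special T g -> special T' h -> special T k ->
  (cayley_dist 1%g h <= cayley_dist 1%g (g * h * k)%g)%N.
Proof.
move=> TT' [s Ts ->] [t Tt ->] [r Tr ->]; rewrite -!raag_word_cat.
have [w [wE <- _]] := geodesic_exists 1 (raag_word ((s ++ t) ++ r)).
move: wE; rewrite mul1g => /raag_wordP/(raag_eq_filter T').
have nT q : all (fun x => T x.1) q -> [seq x <- q | T' x.1] = [::].
  move=> Tq; rewrite -(filter_pred0 q); apply: eq_in_filter => x /(allP Tq) /TT'.
  by move/negbTE.
rewrite !filter_cat (nT s) // (nT r) // cats0 (all_filterP Tt) => /raag_wordP ->.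
rewrite -[X in cayley_dist _ X]mul1g (leq_trans (cayley_dist_le_size _ _)) //.
by rewrite size_filter count_size.
Qed.

(** The cosets of [T] at [g] and [g'] are parallel: moving inside each of them
    cannot bring the two points closer than [g] and [g']. *)
Lemma retraction_dist_coset T T' g g' h h' : (forall v, T v -> ~~ T' v) ->
  special T (g^-1 * h) -> special T (g'^-1 * h') -> special T' (g^-1 * g') ->
  (cayley_dist g g' <= cayley_dist h h')%N.
Proof.
move=> TT' gh gh' gg'.
rewrite -(cayley_distM g^-1) mulVg -(cayley_distM h^-1 h) mulVg.
have -> : h^-1 * h' = (g^-1 * h)^-1 * (g^-1 * g') * (g'^-1 * h').
  by rewrite invgM invgK -!mulgA !mulVKg.
by apply: retraction_dist TT' _ _ _ => //; exact: specialV.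
Qed.

End Words.

(** * Walls of the Cayley graph *)

Section Walls.
Variable G : sgraph.
Local Open Scope classical_set_scope.
Local Open Scope group_scope.
Implicit Types (s t p q r : word G) (g h k d : raag G) (x y z : G * bool)
  (u v : G).

(** The wall dual to the edge from [h] to [h v] is given by [v] and the coset of
    the subgroup generated by the link of [v] that contains [h]: these are the
    starting points of the edges parallel to the given one. *)
Definition wall := (G * set (raag G))%type.
Implicit Types K L W : wall.

(** The end of the edge at which its positively oriented copy starts. *)
Definition edge_base g x := if x.2 then g else g * raag_word [:: x].

Definition wall_of g x : wall :=
  (x.1, [set h | special (edge x.1) ((edge_base g x)^-1 * h)]).

Fixpoint walls g s : seq wall :=
  if s is x :: s' then wall_of g x :: walls (g * raag_word [:: x]) s' else [::].

(** By [raag_eq_crossings], any word for [g] could replace the chosen one.  The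
    element 1 is on the side [false] of every wall. *)
Definition side W g := odd (count_mem W (walls 1 (repr g))).

Lemma wall_ofP g x h y : wall_of g x = wall_of h y <->
  x.1 = y.1 /\ special (edge x.1) ((edge_base g x)^-1 * edge_base h y).
Proof.
rewrite /wall_of; split.
  move=> [xy]; rewrite -{}xy => /predeqP/(_ (edge_base h y)) [_ /=]; rewrite mulVg.
  by move=> H; split=> //; apply/H/special1.
move=> [xy H]; rewrite -xy; congr (_, _); apply/predeqP => k /=.
have E : (edge_base g x)^-1 * k =
    ((edge_base g x)^-1 * edge_base h y) * ((edge_base h y)^-1 * k).
  by rewrite -mulgA mulVKg.
split; last by rewrite E => Hk; exact: specialM.
move=> Hk; rewrite -(mulKg ((edge_base g x)^-1 * edge_base h y) (_^-1 * k)) -E.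
by apply: specialM => //; apply: specialV.
Qed.

Lemma wall_of_base g x : wall_of g x = wall_of (edge_base g x) (x.1, true).
Proof. by []. Qed.

Lemma eq_wall_of g h v : special (edge v) (g^-1 * h) ->
  wall_of g (v, true) = wall_of h (v, true).
Proof. by move=> H; apply/wall_ofP. Qed.

Lemma walls_cat g s t : walls g (s ++ t) = walls g s ++ walls (g * raag_word s) t.
Proof.
elim: s g => [|x s IHs] g /=; first by rewrite mulg1.
by rewrite IHs -mulgA -raag_word_cons.
Qed.

Lemma size_walls g s : size (walls g s) = size s.
Proof. by elim: s g => //= x s IHs g; rewrite IHs. Qed.

Lemma wall_of_cancel g v e :
  wall_of (g * raag_word [:: (v, e)]) (v, ~~ e) = wall_of g (v, e).
Proof.
rewrite (wall_of_base (g * _)) (wall_of_base g) /edge_base /=; congr (wall_of _ _).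
by case: e => //=; rewrite (raag_word_letterV v true) mulgK.
Qed.

Lemma wall_of_commute g u v : edge u v ->
  wall_of (g * raag_word [:: (u, true)]) (v, true) = wall_of g (v, true).
Proof.
move=> uv; apply/esym/eq_wall_of; rewrite mulKg; exists [:: (u, true)] => //=.
by rewrite edge_sym uv.
Qed.

(** Cancelling pairs run twice through one edge, and exchanging two commuting
    letters replaces two edges of a square by the opposite, parallel ones. *)
Lemma raag_eq_crossings W g s t : raag_eq s t ->
  odd (count_mem W (walls g s)) = odd (count_mem W (walls g t)).
Proof.
elim=> {s t} [//|s t _ <-//|s t r _ -> _ <-//|p q v e|p q u v uv].
  rewrite !walls_cat !count_cat !oddD /= wall_of_cancel.
  rewrite -mulgA raag_word_letterV mulgV mulg1.
  by rewrite addKb.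
rewrite !walls_cat !count_cat !oddD /= !wall_of_commute 1?edge_sym //.
rewrite -[g * _ * _ * _]mulgA (edge_commute true true uv) mulgA.
  by congr (_ (+) _); rewrite addbCA.
by rewrite edge_sym.
Qed.

Lemma sideM W g s : side W (g * raag_word s) = side W g (+) odd (count_mem W (walls g s)).
Proof.
have H : raag_eq (repr (g * raag_word s)) (repr g ++ s).
  by apply/raag_wordP; rewrite raag_wordK raag_word_cat raag_wordK.
by rewrite /side (raag_eq_crossings _ _ H) walls_cat count_cat oddD mul1g raag_wordK.
Qed.

Lemma side_step W g x : side W (g * raag_word [:: x]) = side W g (+) (wall_of g x == W).
Proof. by rewrite sideM /= addn0 oddb. Qed.

Lemma mem_walls W g s : W \in walls g s ->
  exists q x r, s = q ++ x :: r /\ W = wall_of (g * raag_word q) x.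
Proof.
elim: s g => //= x s IHs g; rewrite inE => /orP[/eqP ->|/IHs[q [y [r [-> ->]]]]].
  by exists [::], x, s; rewrite mulg1.
by exists (x :: q), y, r; rewrite -mulgA -raag_word_cons.
Qed.

(** If both end letters cross the wall of [v], then [q] is, up to letters [v], in
    the subgroup generated by the link of [v].  Retracting onto the link deletes from
    [q] the letters outside it; the rest commutes with [v], so that at least one of
    the two end letters can be dropped. *)
Lemma cross_twice g x q y : wall_of g x = wall_of (g * raag_word (x :: q)) y ->
  exists s, [/\ subseq s (rcons q y), (size s < (size q).+2)%N &
    raag_word s = raag_word (x :: rcons q y)].
Proof.
case: x y => [v e] [v' e'] /wall_ofP[/= <-{v'}].
set q' := [seq z <- q | edge v z.1].
have irr := @edge_irr G v.
have qq' : subseq q' (rcons q (v, e')).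
  by rewrite -cats1; apply: subseq_trans (filter_subseq _ _) (prefix_subseq _ _).
have q's : (size q' <= size q)%N by rewrite size_filter count_size.
have aq' : all (fun z => edge v z.1) q' by exact: filter_all.
have cq' e0 : commute (raag_word [:: (v, e0)]) (raag_word q').
  apply: (@special_commute _ (pred1 v) (edge v)).
  - by move=> u w /eqP ->.
  - by exists [:: (v, e0)] => //=; rewrite eqxx.
  - by exists q'.
have V : raag_word [:: (v, false)] = (raag_word [:: (v, true)])^-1.
  exact: (raag_word_letterV v true).
have -> : raag_word ((v, e) :: rcons q (v, e')) =
    raag_word [:: (v, e)] * (raag_word q * raag_word [:: (v, e')]).
  by rewrite (raag_word_cons _ (rcons _ _)) -cats1 raag_word_cat.
rewrite /edge_base (raag_word_cons _ q) /=.
move: qq'; case: e; case: e' => qq'; rewrite ?invgM -?mulgA ?mulKg => H.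
- have {}H : special (edge v) (raag_word ((v, true) :: q)) by rewrite raag_word_cons.
  exists (rcons q' (v, true)); split; rewrite ?size_rcons //.
    by rewrite -!cats1 cat_subseq ?filter_subseq.
  rewrite -cats1 raag_word_cat mulgA -raag_word_cons (special_filter H) /= irr.
  by [].
- have {}H : special (edge v) (raag_word ((v, true) :: q ++ [:: (v, false)])).
    by rewrite raag_word_cons raag_word_cat.
  exists q'; split => //; first exact: leq_trans q's _.
  move: (special_filter H); rewrite raag_word_cons raag_word_cat => -> /=.
  by rewrite irr filter_cat /= irr cats0.
- exists q'; split => //; first exact: leq_trans q's _.
  by rewrite (special_filter H) -/q' -(cq' true) V mulKg.
- have {}H : special (edge v) (raag_word (q ++ [:: (v, false)])).
    by rewrite raag_word_cat.
  exists (rcons q' (v, false)); split; rewrite ?size_rcons //.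
    by rewrite -!cats1 cat_subseq ?filter_subseq.
  rewrite -cats1 raag_word_cat -(cq' false) -(raag_word_cat q) (special_filter H).
  by rewrite filter_cat /= irr cats0.
Qed.

Lemma shorten g s : ~~ uniq (walls g s) -> exists s',
  [/\ subseq s' s, (size s' < size s)%N & raag_word s' = raag_word s].
Proof.
elim: s g => [//|x s IHs] g; rewrite [walls _ _]/= cons_uniq negb_and negbK => /orP[|/IHs].
  case/mem_walls=> q [y [r [-> W]]]; rewrite -mulgA -raag_word_cons in W.
  have [s' [s's ss sE]] := cross_twice W.
  have -> : x :: q ++ y :: r = (x :: rcons q y) ++ r by rewrite cat_cons cat_rcons.
  exists (s' ++ r); split; last by rewrite !raag_word_cat sE.
    by rewrite cat_subseq ?(subseq_trans s's (subseq_cons _ _)).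
  by rewrite !size_cat /= size_rcons ltn_add2r.
move=> [s' [s's ss sE]]; exists (x :: s'); split => //=; first by rewrite eqxx.
by rewrite raag_word_cons sE -raag_word_cons.
Qed.

(** A wall that is crossed once has its ends on different sides, so that every
    word with the same value crosses it too. *)
Lemma uniq_geodesic g s : uniq (walls g s) -> geodesic s.
Proof.
move=> us t st; rewrite -(size_walls g s) -(size_walls g t).
apply: uniq_leq_size => // W Ws; rewrite -has_pred1 has_count.
by apply: odd_gt0; rewrite -(raag_eq_crossings W g st) count_uniq_mem // Ws.
Qed.

Lemma geodesic_uniq g s : geodesic s -> uniq (walls g s).
Proof.
move=> gs; apply/negPn/negP => /shorten[s' [_ ss]] /esym/raag_wordP/gs.
by rewrite leqNgt ss.
Qed.

(** Shortening only deletes letters: this is what keeps a product of elements of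
    join subgroups a product of elements of the same subgroups. *)
Lemma geodesic_subseq s : exists s',
  [/\ subseq s' s, geodesic s' & raag_word s' = raag_word s].
Proof.
have [n] := ubnP (size s); elim: n s => // n IHn s sn.
have [/uniq_geodesic us|/shorten[s' [s's ss sE]]] := boolP (uniq (walls 1 s)).
  by exists s.
have [s'' [s''s gs'' s''E]] := IHn s' (leq_trans ss sn).
by exists s''; rewrite s''E sE; split => //; exact: subseq_trans s's.
Qed.

End Walls.

(** * Crossing walls *)

Section Crossings.
Variable G : sgraph.
Local Open Scope classical_set_scope.
Local Open Scope group_scope.
Implicit Types (s t p q r : word G) (g h k d : raag G) (x y z : G * bool)
  (u v : G) (K L W : wall G).

(** Sides of a wall are convex. *)
Lemma side_prefix L g q r : geodesic (q ++ r) ->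
  side L (g * raag_word (q ++ r)) = side L g -> side L (g * raag_word q) = side L g.
Proof.
move=> /(geodesic_uniq g) us; rewrite !sideM walls_cat => E.
suff -> : count_mem L (walls g q) = 0%N by rewrite addbF.
move: us E; rewrite walls_cat => us.
have := count_uniq_mem L us; rewrite count_cat.
case: (_ \in _) => [->|]; first by case: side.
by move/eqP; rewrite addn_eq0 => /andP[/eqP].
Qed.

Lemma side_neq_mem W g s : side W (g * raag_word s) != side W g -> W \in walls g s.
Proof.
rewrite sideM => H; rewrite -has_pred1 has_count; apply: odd_gt0.
by move: H; case: side; case: odd.
Qed.

Lemma geodesic_side W g s : geodesic s ->
  side W (g * raag_word s) = side W g (+) (W \in walls g s).
Proof.
by move=> /(geodesic_uniq g) us; rewrite sideM count_uniq_mem // oddb.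
Qed.

(** A geodesic inside one side of [L] crosses [K], and it does so along an edge
    that lies on that side. *)
Lemma edge_crossing K L g h : side L g = side L h -> side K g != side K h ->
  exists d u, K = wall_of d (u, true) /\ side L d = side L g.
Proof.
move=> Lgh Kgh; have [s [hE _ gs]] := geodesic_exists g h.
move: Lgh Kgh; rewrite {}hE eq_sym => Lgh /side_neq_mem /mem_walls[q [x [r [sE KE]]]].
exists (edge_base (g * raag_word q) x), x.1; split => //.
rewrite {}sE in gs Lgh; rewrite /edge_base; case: x.2.
  exact: side_prefix gs (esym Lgh).
rewrite -mulgA -raag_word_cat; rewrite -cat1s catA in gs Lgh.
exact: side_prefix gs (esym Lgh).
Qed.

(** When all four intersections of sides are inhabited, [K] is dual to an edge on
    either side of [L].  These two edges are joined by a path that runs along [K]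
    and only uses letters of the link of [u]; it has to cross [L], which gives a
    square. *)
Lemma cross_square K L g g' h h' :
    side L g = side L g' -> side K g != side K g' ->
    side L h = side L h' -> side K h != side K h' -> side L g != side L h ->
  exists d u v, [/\ edge u v, K = wall_of d (u, true) & L = wall_of d (v, true)].
Proof.
move=> Lg Kg Lh Kh; have [d1 [u [K1 <-]]] := edge_crossing Lg Kg.
have [d2 [u2 [K2 <-]]] := edge_crossing Lh Kh.
move: (K2); rewrite K1 => /wall_ofP[/= uu2]; rewrite -{u2}uu2 in K2 *.
move=> [s us sE]; have -> : d2 = d1 * raag_word s by rewrite -sE /edge_base /= mulVKg.
rewrite eq_sym => /side_neq_mem /mem_walls[q [x [r [sqr ->]]]].
move: us; rewrite sqr all_cat /= => /and3P[uq ux _].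
exists (edge_base (d1 * raag_word q) x), u, x.1; split => //.
apply: eq_wall_of; rewrite /edge_base; case: x.2.
  by rewrite mulKg; exists q.
by rewrite -mulgA mulKg -raag_word_cat; exists (q ++ [:: x]); rewrite // all_cat uq /= ux.
Qed.

Definition star v : pred G := [pred u | (u == v) || edge v u].

(** The star of a vertex with a neighbour is the join of the vertex and its link. *)
Lemma star_join v u g : edge v u -> special (star v) g -> in_join_subgroup g.
Proof.
move=> vu Sg; exists (v |: [set w | edge v w])%SET.
  exists [set v]%SET, [set w | edge v w]%SET; split => //.
  - by apply/set0Pn; exists v; rewrite inE.
  - by apply/set0Pn; exists u; rewrite inE.
  - apply/setP => w; rewrite !inE; apply/negP => /andP[/eqP ->].
    by rewrite edge_irr.
  - by move=> w w' /set1P -> ; rewrite inE.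
apply/subgroup_of_verticesP; apply: special_sub Sg => w.
by rewrite /= !inE.
Qed.

(** Three factors suffice to walk from an edge to another one through a wall that
    crosses the walls of both. *)
Definition join_triple g := exists g1 g2 g3,
  [/\ in_join_subgroup g1, in_join_subgroup g2, in_join_subgroup g3 & g = g1 * g2 * g3].

Lemma wall_star g x d v : wall_of g x = wall_of d (v, true) -> special (star v) (g^-1 * d).
Proof.
case: x => v' e /wall_ofP[/= -> {v'}]; rewrite {2}/edge_base /= => H.
have -> : g^-1 * d = (g^-1 * edge_base g (v, e)) * ((edge_base g (v, e))^-1 * d).
  by rewrite -mulgA mulVKg.
apply: specialM; last by apply: special_sub H => w vw; rewrite /star /= vw orbT.
rewrite /edge_base /=; case: e {H}; first by rewrite mulVg; exact: special1.
by rewrite mulKg; exists [:: (v, false)]; rewrite /= /star /= ?eqxx.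
Qed.

Lemma square_join_triple g x h y d u v : edge u v ->
    wall_of g x = wall_of d (u, true) -> wall_of h y = wall_of d (v, true) ->
  join_triple (g^-1 * h).
Proof.
move=> uv /wall_star gd /wall_star hd; exists (g^-1 * d), 1, (d^-1 * h); split.
- exact: star_join uv gd.
- by apply: (star_join uv); exact: special1.
- apply: (@star_join v u); first by rewrite edge_sym.
  by rewrite -[d^-1 * h]invgK invgM invgK; exact: specialV.
- by rewrite mulg1 -mulgA mulVKg.
Qed.

Lemma count_mem_leq (T : eqType) (s t : seq T) : uniq s -> (count (mem t) s <= size t)%N.
Proof.
move=> us; rewrite -size_filter; apply: uniq_leq_size; first exact: filter_uniq.
by move=> z; rewrite mem_filter => /andP[].
Qed.

(** The walls [L1] and [L2] do not cross and no wall crosses both, because either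
    would make [p^-1 * q] a product of three elements of join subgroups.  Then a
    wall crossed both on the way from [X] to [p] and on the way from [q] to [Y]
    must be crossed between [p] and [q]; the walls crossed on one of the two ways,
    but not between [p] and [q], separate [X] from [Y]. *)
Lemma separated_dist (p q X Y : raag G) x y (L1 := wall_of p x) (L2 := wall_of q y) :
    side L1 X = side L1 p -> side L1 q != side L1 p ->
    side L1 (q * raag_word [:: y]) = side L1 q ->
    side L2 p = side L2 q -> side L2 Y != side L2 q ->
    ~ join_triple (p^-1 * q) ->
  (cayley_dist X p + cayley_dist q Y <= cayley_dist X Y + (cayley_dist p q).*2)%N.
Proof.
move=> L1X L1q L1qy L2p L2Y npq.
have L2qy : side L2 (q * raag_word [:: y]) = ~~ side L2 q.
  by rewrite side_step eqxx addbT.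
have ncross g g' : side L1 g = side L1 g' -> side L1 g != side L1 q -> 
    side L2 g = side L2 g'.
  move=> L1g gq; apply/eqP/negPn/negP => L2g; apply: npq.
  have [|d [u [v [uv E2 E1]]]] := cross_square L1g L2g (esym L1qy) _ gq.
    by rewrite L2qy; case: side.
  by apply: square_join_triple E1 E2; rewrite edge_sym.
have L2X : side L2 X = side L2 q.
  by rewrite -L2p; apply: ncross; rewrite // L1X eq_sym.
have L1Y : side L1 Y = side L1 q.
  apply/eqP/negPn/negP => nY; have : side L1 Y = side L1 p.
    by move: L1q nY; case: (side L1 q); case: (side L1 Y); case: (side L1 p).
  by move/ncross => /(_ nY) E; move: L2Y; rewrite E L2p eqxx.
have [P [pE <- gP]] := geodesic_exists X p.
have [t [qE <- gt]] := geodesic_exists p q.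
have [Q [YE <- gQ]] := geodesic_exists q Y.
have [R [YR <- gR]] := geodesic_exists X Y.
have uP := geodesic_uniq X gP; have uQ := geodesic_uniq q gQ.
have ut := geodesic_uniq p gt.
have disj K : K \in walls X P -> K \in walls q Q -> K \in walls p t.
  move=> KP KQ; apply/negPn/negP => Kt; apply: npq.
  have Kp : side K p = ~~ side K X by rewrite pE geodesic_side // KP addbT.
  have Kq : side K q = side K p by rewrite qE geodesic_side // (negbTE Kt) addbF.
  have KY : side K Y = ~~ side K q by rewrite YE geodesic_side // KQ addbT.
  (* [L2] separates [X] from [Y], and [K], crossed twice, does not. *)
  have KL2 : wall_of q y != K.
    apply: contra L2Y => /eqP; rewrite -/L2 => E.
    by rewrite -L2X E KY Kq Kp negbK.
  have [||||d1 [u [v [uv K1 E1]]]] := @cross_square K L1 X p q Y L1X.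
  - by rewrite Kp; case: side.
  - by rewrite L1Y.
  - by rewrite KY; case: side.
  - by rewrite L1X eq_sym.
  have [|||||d2 [u2 [v2 [uv2 K2 E2]]]] := @cross_square K L2 X p Y (q * raag_word [:: y]).
  - by rewrite L2X.
  - by rewrite Kp; case: side.
  - by rewrite L2qy; move: L2Y; case: side; case: side.
  - by rewrite side_step (negbTE KL2) addbF KY; case: side.
  - by rewrite L2X eq_sym.
  exists (p^-1 * d1), (d1^-1 * d2), (d2^-1 * q); split.
  - by apply: (@star_join v u); [rewrite edge_sym|exact: wall_star E1].
  - by apply: (star_join uv2); rewrite K1 in K2; exact: wall_star K2.
  - apply: (@star_join v2 u2); first by rewrite edge_sym.
    rewrite -[d2^-1 * q]invgK invgM invgK; apply: specialV; exact: wall_star E2.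
  - by rewrite -!mulgA !mulVKg.
(* The walls crossed by [P] or [Q], but not by [t], separate [X] from [Y]. *)
pose nt := [pred W | W \notin walls p t].
have cP : (size P <= count nt (walls X P) + size t)%N.
  rewrite -(size_walls X) -(count_predC (mem (walls p t))) addnC leq_add2l.
  by rewrite -(size_walls p t); exact: count_mem_leq.
have cQ : (size Q <= count nt (walls q Q) + size t)%N.
  rewrite -(size_walls q) -(count_predC (mem (walls p t))) addnC leq_add2l.
  by rewrite -(size_walls p t); exact: count_mem_leq.
suff : (count nt (walls X P) + count nt (walls q Q) <= size R)%N.
  by move: cP cQ; lia.
rewrite -!size_filter -size_cat -(size_walls X R); apply: uniq_leq_size.
  rewrite cat_uniq !filter_uniq // andbT /=; apply/hasPn => K.
  rewrite !mem_filter /= => /andP[Kt KQ]; rewrite negb_and Kt /=.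
  by apply: contra Kt => /disj; apply.
move=> K; rewrite mem_cat !mem_filter /= -andb_orr => /andP[Kt KPQ].
apply: side_neq_mem; rewrite -YR.
have -> : side K Y = side K X (+) (K \in walls X P) (+) (K \in walls q Q).
  rewrite YE (geodesic_side _ _ gQ) qE (geodesic_side _ _ gt) (negbTE Kt) addbF.
  by rewrite -qE pE (geodesic_side _ _ gP).
move: KPQ.
case KP: (K \in walls X P); case KQ: (K \in walls q Q) => //=.
- by rewrite disj in Kt.
- by case: side.
- by case: side.
Qed.

End Crossings.

(** * Barriers along a geodesic *)

Section Barriers.
Variable G : sgraph.
Local Open Scope classical_set_scope.
Local Open Scope group_scope.
Implicit Types (a b c g h d : raag G) (s t w : word G) (x y : G * bool)
  (X Y : raag G) (i j k l m n : nat).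

Definition vert a w i : raag G := a * raag_word (take i w).

Definition start_side a w i X : bool :=
  if drop i w is x :: _ then
    side (wall_of (vert a w i) x) X == side (wall_of (vert a w i) x) a
  else true.

Lemma vert_catl a w i j : (i <= j)%N ->
  vert a w j = vert a w i * raag_word (take (j - i) (drop i w)).
Proof.
move=> ij; rewrite /vert -mulgA -raag_word_cat take_drop subnK //.
by rewrite -{1}(take_takel w ij) cat_take_drop.
Qed.

Lemma dist_vert a w i j : (i <= j)%N -> (cayley_dist (vert a w i) (vert a w j) <= j - i)%N.
Proof.
move=> ij; rewrite (vert_catl a w ij) (leq_trans (cayley_dist_le_size _ _)) //.
by rewrite size_take_min geq_minl.
Qed.

Lemma vertS a w i x s : drop i w = x :: s ->
  vert a w i.+1 = vert a w i * raag_word [:: x].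
Proof. by move=> E; rewrite (vert_catl a w (leqnSn i)) subSnn E /= take0. Qed.

Lemma walls_take g s i : walls g (take i s) = take i (walls g s).
Proof.
have [si|/ltnW si] := leqP (size s) i; first by rewrite !take_oversize ?size_walls.
by rewrite -{2}(cat_take_drop i s) walls_cat take_size_cat // size_walls size_takel.
Qed.

Lemma walls_nth g s i x r (W : wall G) : drop i s = x :: r ->
  nth W (walls g s) i = wall_of (g * raag_word (take i s)) x.
Proof.
move=> E; have si : (i < size s)%N.
  by rewrite ltnNge; apply/negP => /drop_oversize; rewrite E.
rewrite -{1}(cat_take_drop i s) walls_cat nth_cat size_walls size_take si ltnn.
by rewrite subnn E.
Qed.

Lemma side_vert a w i j x s : geodesic w -> drop i w = x :: s ->
  side (wall_of (vert a w i) x) (vert a w j) =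
  side (wall_of (vert a w i) x) a (+) (i < j)%N.
Proof.
move=> /(geodesic_uniq a) uw E; have si : (i < size w)%N.
  by rewrite ltnNge; apply/negP => /drop_oversize; rewrite E.
rewrite {2}/vert sideM walls_take count_uniq_mem ?take_uniq // oddb.
set W := wall_of _ _; have WE : nth W (walls a w) i = W by rewrite (walls_nth _ _ E).
have Ww : W \in walls a w by rewrite -WE mem_nth // size_walls.
have ix : index W (walls a w) = i by rewrite -{1}WE index_uniq // size_walls.
by rewrite in_take // ix.
Qed.

Lemma start_sideP a w i : (i < size w)%N -> exists x s, drop i w = x :: s /\
  forall X, start_side a w i X =
    (side (wall_of (vert a w i) x) X == side (wall_of (vert a w i) x) a).
Proof.
move=> iw; case E: (drop i w) => [|x s].
  by have := size_drop i w; rewrite E /=; lia.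
by exists x, s; split => // X; rewrite /start_side E.
Qed.

Lemma start_side_source a w i : start_side a w i a.
Proof. by rewrite /start_side; case: drop => // x s; rewrite eqxx. Qed.

Lemma start_side_target a w i : geodesic w -> (i < size w)%N -> ~~ start_side a w i (a * raag_word w).
Proof.
move=> gw iw; have [x [s [E ->]]] := start_sideP a iw.
rewrite -{2}(take_size w) -/(vert a w (size w)) (side_vert _ _ gw E) iw.
by case: side.
Qed.

(** Two edges of the path whose walls cannot be linked through stars. *)
Definition separated a w i j : bool :=
  (i < j)%N && ~~ `[< join_triple ((vert a w i)^-1 * vert a w j) >].

Lemma separated_edges_dist a w i j X Y : geodesic w -> (j < size w)%N -> separated a w i j ->
    start_side a w i X -> ~~ start_side a w j Y ->
  (cayley_dist X (vert a w i) + cayley_dist (vert a w j) Y <=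
   cayley_dist X Y + (j - i).*2)%N.
Proof.
move=> gw jw /andP[ij /asboolP nt]; have iw := ltn_trans ij jw.
have [x [s [Ex ->]]] := start_sideP a iw; have [y [t [Ey ->]]] := start_sideP a jw.
move=> /eqP nX nY; have dij := dist_vert a w (ltnW ij).
suff : (cayley_dist X (vert a w i) + cayley_dist (vert a w j) Y <=
   cayley_dist X Y + (cayley_dist (vert a w i) (vert a w j)).*2)%N.
  by move: dij; lia.
have Li := fun j => side_vert a j gw Ex; have Lj := fun i => side_vert a i gw Ey.
apply: (separated_dist (x := x) (y := y)) => //.
- by rewrite Li ltnn addbF.
- by rewrite !Li ltnn ij; case: side.
- by rewrite -(vertS a Ey) !Li ij ltnS (ltnW ij).
- by rewrite !Lj ltnn ltnNge (ltnW ij).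
- by rewrite Lj ltnn addbF.
Qed.

(** Single letters are admitted as factors so that the argument also covers the
    graph with one vertex, which contains no join. *)
Definition factorable n g := exists s : seq (raag G),
  [/\ (size s <= n)%N, g = \prod_(h <- s) h &
    forall h, h \in s -> in_join_subgroup h \/ exists x, h = raag_word [:: x]].

Lemma factorable_leq m n g : (m <= n)%N -> factorable m g -> factorable n g.
Proof. by move=> mn [s [sm gE sJ]]; exists s; split => //; apply: leq_trans mn. Qed.

Lemma factorable1 : factorable 0 1.
Proof. by exists [::]; rewrite big_nil. Qed.

Lemma factorableM m n g h : factorable m g -> factorable n h -> factorable (m + n) (g * h).
Proof.
move=> [s [sm -> sJ]] [t [tn -> tJ]]; exists (s ++ t); split.
- by rewrite size_cat leq_add.
- by rewrite big_cat.
- by move=> d; rewrite mem_cat => /orP[/sJ|/tJ].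
Qed.

Lemma factorable_letter x : factorable 1 (raag_word [:: x]).
Proof.
exists [:: raag_word [:: x]]; rewrite big_seq1; split => // h.
by rewrite inE => /eqP ->; right; exists x.
Qed.

Lemma factorable_join g : in_join_subgroup g -> factorable 1 g.
Proof.
move=> Jg; exists [:: g]; rewrite big_seq1; split => // h.
by rewrite inE => /eqP ->; left.
Qed.

(** An edge that is not separated from the edge [i] is reached from there with three
    join factors; one more letter leads to its end. *)
Lemma factorable_step a w i j : (i < j <= size w)%N -> ~~ separated a w i j.-1 ->
  factorable 4 ((vert a w i)^-1 * vert a w j).
Proof.
case: j => // j /andP[ij jw] /= nij.
have [x [s [E _]]] := start_sideP a jw; rewrite (vertS a E) mulgA.
apply: (@factorableM 3 1); last exact: factorable_letter.
move: ij; rewrite ltnS leq_eqVlt => /orP[/eqP ->|ij].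
  by rewrite mulVg; exact: factorable_leq factorable1.
move: nij; rewrite /separated ij negbK => /asboolP[g1 [g2 [g3 [J1 J2 J3 ->]]]].
by apply: (@factorableM 2 1); [apply: (@factorableM 1 1)|]; exact: factorable_join.
Qed.

(** Going from each edge to the first one separated from it, either [m] steps are
    possible, or the path is used up after fewer steps, each of which costs at most
    four factors. *)
Lemma greedy a w m i n : (i <= n <= size w)%N ->
  (exists p, [/\ path (separated a w) i p, size p = m & (last i p < n)%N]) \/
  factorable (4 * m) ((vert a w i)^-1 * vert a w n).
Proof.
elim: m i => [|m IHm] i /andP[in_ nw].
  have [iE|ni] := eqVneq i n; last by left; exists [::]; rewrite /= ltn_neqAle ni.
  by right; rewrite iE mulVg; exact: factorable1.
have [[j /andP[/andP[ij jn] sij]]|none] :=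
    pselect (exists j, (i < j < n)%N && separated a w i j).
  have ex : exists j, (i < j < n)%N && separated a w i j by exists j; rewrite ij jn.
  case: (ex_minnP ex) => {ij jn sij}j /andP[/andP[ij jn] sij] jmin.
  have [|[p [pj sp lp]]|F] := IHm j; first by rewrite (ltnW jn).
    by left; exists (j :: p); rewrite /= sij sp.
  right; have -> : (vert a w i)^-1 * vert a w n =
      ((vert a w i)^-1 * vert a w j) * ((vert a w j)^-1 * vert a w n).
    by rewrite -mulgA mulVKg.
  rewrite mulnS; apply: factorableM F; apply: factorable_step.
    by rewrite ij (leq_trans (ltnW jn)).
  apply/negP => sij'; have ij' := sij'; case/andP: ij' => ij' _.
  have := jmin j.-1; rewrite sij' ij' /=; move: ij jn; case: (j) => //= k _ kn.
  by rewrite (ltn_trans _ kn) // ltnn => /(_ isT).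
right; move: in_; rewrite leq_eqVlt => /orP[/eqP ->|in_].
  by rewrite mulVg; exact: factorable_leq factorable1.
apply: (@factorable_leq 4); first by rewrite mulnS leq_addr.
apply: factorable_step; first by rewrite in_.
apply/negP => s'; apply: none; exists n.-1; rewrite s'; case/andP: s' => -> _.
by move: in_; case: (n) => //= k; rewrite ltnS leqnn.
Qed.

(** Among [k.+1] consecutive blocks of [m] steps one has at most the average
    length. *)
Lemma greedy_chunk (r : rel nat) m k i p : path r i p ->
    (forall k l, r k l -> (k < l)%N) -> size p = (k.+1 * m)%N ->
  exists j q, [/\ path r j q, size q = m, (i <= j)%N, (last j q <= last i p)%N &
    (k.+1 * (last j q - j) <= last i p - i)%N].
Proof.
move=> + rlt; elim: k i p => [|k IHk] i p ip sp.
  by rewrite mul1n in sp; exists i, p; rewrite mul1n.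
have mono q j : path r j q -> (j <= last j q)%N.
  elim: q j => //= y q IHq j /andP[/rlt/ltnW jy /IHq]; exact: leq_trans.
move: ip; rewrite -(cat_take_drop m p) cat_path last_cat => /andP[i1 i2].
have s1 : size (take m p) = m by rewrite size_takel // sp; nia.
have s2 : size (drop m p) = (k.+1 * m)%N by rewrite size_drop sp; nia.
have [j [q [jq sq ij lq kq]]] := IHk _ _ i2 s2.
have m1 := mono _ _ i1; have m2 := mono _ _ i2; have m3 := mono _ _ jq.
set e := last i (take m p) in m1 m2 ij lq kq *.
set f := last e (drop m p) in m2 lq kq *.
have [c|c] := leqP (k.+2 * (e - i)) (f - i).
  by exists i, (take m p).
exists j, q; split => //; first exact: leq_trans ij.
nia.
Qed.

(** The predicates [H k] single out the starting side of the [k]-th of a sequence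
    of walls from [a] to [b].  Getting from one wall past the next one is as long
    as a detour through [c], up to the error [n]. *)
Definition barrier a b c m n := exists H : nat -> raag G -> bool,
  [/\ forall k, (k <= m)%N -> H k a, forall k, (k <= m)%N -> ~~ H k b &
    forall k X Y, (k < m)%N -> H k X -> ~~ H k.+1 Y ->
    (cayley_dist X c + cayley_dist c Y <= cayley_dist X Y + n)%N].

(** Cutting [m.+1 * m] separated edges into [m.+1] blocks leaves [m] of them on a
    piece of the path whose length is at most the [m.+1]-st part of the whole. *)
Lemma barrier_exists a w m i n : geodesic w -> (i <= n <= size w)%N ->
  factorable (4 * (m.+1 * m)) ((vert a w i)^-1 * vert a w n) \/
  exists j e, [/\ (i <= j < n)%N, (m.+1 * e <= 4 * (n - i))%N &
    barrier a (a * raag_word w) (vert a w j) m e].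
Proof.
move=> gw inw; have [[p [ip sp lp]]|F] := greedy a (m.+1 * m) inw; last by left.
right; have slt k l : separated a w k l -> (k < l)%N by case/andP.
have [j [q [jq sq ij lq kq]]] := greedy_chunk ip slt sp.
have mono k : (k <= m)%N -> (j <= nth 0%N (j :: q) k <= last j q)%N.
  have le_jq : sorted leq (j :: q).
    by apply: sub_path jq => k' l /andP[/ltnW].
  have nth_le := sorted_leq_nth leq_trans leqnn 0%N le_jq.
  have last_q : last j q = nth 0%N (j :: q) m by rewrite -sq (last_nth 0%N).
  have sjq : size (j :: q) = m.+1 by rewrite /= sq.
  move=> km; rewrite last_q -[X in (X <= _ <= _)%N]/(nth 0%N (j :: q) 0).
  by rewrite !nth_le ?inE ?sjq ?ltnS.
have lw : (last j q < size w)%N by case/andP: inw => _; apply: leq_trans; apply: leq_ltn_trans lp.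
exists j, (4 * (last j q - j))%N; split.
- have := mono 0%N isT; rewrite ij /= => /andP[_ H].
  by apply: leq_ltn_trans lp; apply: leq_trans lq.
- by rewrite mulnCA leq_mul2l /= (leq_trans kq) // leq_sub2r // ltnW.
exists (fun k => start_side a w (nth 0%N (j :: q) k)); split.
- by move=> k _; exact: start_side_source.
- move=> k /mono/andP[_ kl]; apply: start_side_target => //; exact: leq_ltn_trans lw.
move=> k X Y km nX nY.
have /andP[k1 k2] := mono k (ltnW km); have /andP[l1 l2] := mono k.+1 km.
have sk : separated a w (nth 0%N (j :: q) k) (nth 0%N (j :: q) k.+1).
  by have := pathP 0%N jq; rewrite sq; move/(_ k km).
have := separated_edges_dist gw (leq_ltn_trans l2 lw) sk nX nY.
(* Both edges are within the length of the block from its first vertex. *)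
have d1 := dist_vert a w k1; have d2 := dist_vert a w l1.
move: d1 d2 k1 k2 l1 l2.
set v0 := vert a w j; set v1 := vert a w _; set v2 := vert a w _.
have t1 := cayley_dist_triangle v1 X v0; have t2 := cayley_dist_triangle v2 v0 Y.
move: t1; rewrite (cayley_dist_sym v1 v0); lia.
Qed.

End Barriers.

(** * Join subgroups and join length *)

Section Joins.
Variable G : sgraph.
Local Open Scope classical_set_scope.
Local Open Scope group_scope.
Implicit Types (g h : raag G) (s t : word G) (u v : G) (J : {set G}).

Lemma connected_neighbour : connected_graph G ->
  (exists u v, edge u v) -> forall u, exists v, edge u v.
Proof.
move=> Gc [u [v uv]] x; have [->|xu] := eqVneq x u; first by exists v.
have /connectP[[|y p] /= xp uE] := Gc x u; first by rewrite uE eqxx in xu.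
by exists y; case/andP: xp.
Qed.

Lemma letter_join u v e : edge u v -> in_join_subgroup (raag_word [:: (u, e)]).
Proof. by move=> uv; apply: (star_join uv); exists [:: (u, e)]; rewrite //= /star /= eqxx. Qed.

Lemma edge_is_join u v : edge u v -> is_join [set u; v]%SET.
Proof.
move=> uv; exists [set u]%SET, [set v]%SET; split => //.
- by apply/set0Pn; exists u; rewrite inE.
- by apply/set0Pn; exists v; rewrite inE.
- apply/setP => x; rewrite !inE; apply/negP => /andP[/eqP -> /eqP uv'].
  by rewrite uv' edge_irr in uv.
- by move=> x y /set1P -> /set1P ->.
Qed.

Lemma factorable_join_length (R : realType) n g :
    (forall u, exists v, edge u v) -> factorable n g ->
  (join_length R g <= n%:R%:E)%E.
Proof.
move=> nb [s [sn gE sJ]]; apply: (@le_trans _ _ (size s)%:R%:E); last first.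
  by rewrite lee_fin ler_nat.
apply: ereal_inf_lbound; exists (size s) => //; exists s; split => // h /sJ[//|[[u e] ->]].
by have [v uv] := nb u; exact: letter_join uv.
Qed.

(** Without edges the only factors are letters. *)
Lemma factorable_dist n g : ~ (exists u v : G, edge u v) -> factorable n g ->
  (cayley_dist 1%g g <= n)%N.
Proof.
move=> nE [s [sn -> sJ]]; apply: leq_trans sn; elim: s sJ => [|h s IHs] sJ.
  by rewrite big_nil cayley_distxx.
rewrite big_cons; apply: leq_trans (cayley_dist_triangle h _ _) _.
rewrite -{2}[h]mulg1 cayley_distM -[size _]add1n leq_add //; last first.
  by apply: IHs => k ks; apply: sJ; rewrite inE ks orbT.
have [[J [J1 [J2 [/set0Pn[u uJ1] /set0Pn[v vJ2] _ _ E]]] _]|[x ->]] := sJ h (mem_head _ _).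
  by case: nE; exists u, v; exact: E.
by rewrite -[raag_word _]mul1g cayley_dist_le_size.
Qed.

(** All letters of the first kind commute with those of the second kind, so they
    can be moved to the front. *)
Lemma special_product (T1 T2 : pred G) g :
    (forall u v, T1 u -> T2 v -> edge u v) -> special (fun v => T1 v || T2 v) g ->
  exists p q, [/\ special T1 p, special T2 q & g = p * q].
Proof.
move=> E [s Ts ->]; elim: s Ts => [|x s IHs] /=.
  by exists 1, 1; rewrite mulg1; split => //; exact: special1.
case/andP=> Tx /IHs[p [q [Tp Tq sE]]]; rewrite raag_word_cons sE.
case/orP: Tx => Tx.
  exists (raag_word [:: x] * p), q; rewrite mulgA; split => //.
  by apply: specialM => //; exists [:: x] => //=; rewrite Tx.
have Sx : special T2 (raag_word [:: x]) by exists [:: x] => //=; rewrite Tx.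
exists p, (raag_word [:: x] * q); split => //; first exact: specialM.
by rewrite !mulgA (special_commute E Tp Sx).
Qed.

(** The exponent sum of [v] is invariant; it is split into two counts to remain
    within the natural numbers. *)
Lemma dist_pow v n : cayley_dist 1 (gen v ^+ n) = n.
Proof.
have -> : gen v ^+ n = 1 * raag_word (nseq n (v, true)).
  rewrite mul1g; elim: n => [|n IHn]; first by rewrite expg0.
  by rewrite expgS IHn (raag_word_cons _ (nseq n _)).
rewrite geodesic_dist ?size_nseq // => t vt; rewrite size_nseq.
suff H s s' : raag_eq s s' ->
    (count_mem (v, true) s + count_mem (v, false) s' =
     count_mem (v, true) s' + count_mem (v, false) s)%N.
  have := H _ _ vt; rewrite !count_nseq /= eqxx mul1n xpair_eqE andbF mul0n addn0 => E.
  by apply: leq_trans (count_size (pred1 (v, true)) t); rewrite -E leq_addr.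
elim=> {s s'} [//|s s' _ ->//|s s' r _ E1 _ E2|p q u e|p q u u' _].
- by move: E1 E2; lia.
- rewrite !count_cat /= !xpair_eqE; case: e; case: (u == v) => /=; lia.
- rewrite !count_cat /= !xpair_eqE; lia.
Qed.

Definition join_word s := exists2 J : {set G}, is_join J & all (fun x => x.1 \in J) s.

(** Reducing the concatenated word to a geodesic makes all partial products stay on
    a geodesic, hence within linear distance of its ends. *)
Lemma join_expressible_words g k : join_expressible g k -> exists ss : seq (word G),
  [/\ size ss = k, g = raag_word (flatten ss), geodesic (flatten ss) &
      forall s, s \in ss -> join_word s].
Proof.
move=> [gs [sk gsJ gE]].
have [ss [ssk ssE ssJ]] : exists ss : seq (word G),
    [/\ size ss = k, raag_word (flatten ss) = g & forall s, s \in ss -> join_word s].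
  move: sk gsJ; rewrite {}gE; elim: gs k => [|h gs IHgs] k /=.
    by move=> <- _; exists [::]; rewrite big_nil.
  move=> <- gsJ; have [|ss [ssk ssE ssJ]] := IHgs _ erefl.
    by move=> a ags; apply: gsJ; rewrite inE ags orbT.
  have [J Jj /subgroup_of_verticesP[s Js sE]] := gsJ h (mem_head _ _).
  exists (s :: ss); split; rewrite /= ?ssk // ?big_cons ?raag_word_cat ?ssE ?sE //.
  by move=> t; rewrite inE => /orP[/eqP ->|/ssJ//]; exists J.
have [t [ts gt tE]] := geodesic_subseq (flatten ss).
rewrite -{}ssE -{}tE; suff [tt [stt ttE ttJ]] : exists tt : seq (word G),
    [/\ size tt = k, t = flatten tt & forall s, s \in tt -> join_word s].
  by exists tt; rewrite -ttE.
move: ts {gt}; rewrite -{}ssk; elim: ss t ssJ => [|s ss IHss] t ssJ.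
  by rewrite subseq0 => /eqP ->; exists [::].
rewrite [flatten _]/=.
case/subseqP=> m sm ->; rewrite -(cat_take_drop (size s) m).
rewrite mask_cat; last by rewrite size_takel // sm size_cat leq_addr.
have [|tt [stt ttE ttJ]] := IHss (mask (drop (size s) m) (flatten ss)) _ (mask_subseq _ _).
  by move=> r rs; apply: ssJ; rewrite inE rs orbT.
exists (mask (take (size s) m) s :: tt); rewrite /= -ttE; split => //; first by rewrite stt.
move=> r; rewrite inE => /orP[/eqP ->|/ttJ//].
have [J Jj Js] := ssJ s (mem_head _ _); exists J => //.
by apply/allP => x /mem_mask; exact: (allP Js).
Qed.

End Joins.

(** * Distances and paths in the cone *)

Section Cone.
Context {R : realType} {G : sgraph} (D : cone_data R (cayley R G)).
Local Notation w := (cone_filter D).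
Local Notation d := (scaling D).
Local Open Scope classical_set_scope.
Local Open Scope ring_scope.
Implicit Types (x y z : admissible_seq D) (c a b : acone D) (g h : nat -> raag G)
  (C M eps : R) (T : pred G).

Definition term x (n : nat) : raag G := sval x n.

Definition dist (g h : raag G) : R := (cayley_dist g h)%:R.

Lemma dist_sym (g h : raag G) : dist g h = dist h g.
Proof. by rewrite /dist cayley_dist_sym. Qed.

Lemma dist_triangle (h g k : raag G) : dist g k <= dist g h + dist h k.
Proof. by rewrite /dist -natrD ler_nat cayley_dist_triangle. Qed.

Lemma distxx (g : raag G) : dist g g = 0.
Proof. by rewrite /dist cayley_distxx. Qed.

Lemma scaled_distE g h n : scaled_dist D g h n = dist (g n) (h n) / d n.
Proof. by []. Qed.

Lemma scaling_ge M : \forall n \near w, M <= d n.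
Proof. by have /cvgryPge := @scaling_infty _ _ D; exact. Qed.

(** Finiteness of the limit needs convergence, which boundedness provides because
    the filter is an ultrafilter. *)
Lemma ultra_lim_lty (u : nat -> \bar R) M :
  (\forall n \near w, (0 <= u n <= M%:E)%E) -> (lim (u @ w) < +oo)%E.
Proof.
move=> uM; have : cvg ((fine \o u) @ w).
  apply: (@ultra_bounded_cvg _ _ _ _ M); near=> n => /=.
  have : (0 <= u n <= M%:E)%E by near: n.
  case: (u n) => [r||] /andP[]; last by rewrite leeNy_eq.
    by rewrite !lee_fin => r0 rM; rewrite ger0_norm.
  by rewrite leye_eq.
move=> /cvg_ex[l ul]; have /cvg_lim -> // : u @ w --> l%:E; last exact: ltry.
apply: cvg_EFin => //; near=> n.
have : (0 <= u n <= M%:E)%E by near: n.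
by case: (u n) => [r||] /andP[] //; rewrite ?leye_eq ?leeNy_eq.
Unshelve. all: by end_near. Qed.

Lemma admissibleP g : admissible D g <->
  exists M, \forall n \near w, dist (observation D n) (g n) <= M * d n.
Proof.
split.
  move=> /ultra_lim_ltey_bounded[M wM]; exists M.
  near=> n; rewrite -ler_pdivrMr; last by near: n; exact: scaling_gt0.
  by near: n; apply: filterS wM => n /=; rewrite lee_fin.
move=> [M wM]; apply: (@ultra_lim_lty _ M); near=> n.
rewrite !lee_fin; apply/andP; split; first by near: n; exact: scaled_dist_ge0.
rewrite scaled_distE ler_pdivrMr; last by near: n; exact: scaling_gt0.
by near: n.
Unshelve. all: by end_near. Qed.

Lemma admissible_near x g C : (\forall n \near w, dist (term x n) (g n) <= C * d n) ->
  admissible D g.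
Proof.
have /admissibleP[M xM] := svalP x => gC; apply/admissibleP; exists (M + C).
near=> n; apply: le_trans (dist_triangle (term x n) _ _) _.
by rewrite mulrDl lerD //; near: n.
Unshelve. all: by end_near. Qed.

Lemma mdist_cone x y : mdist (cone_point x) (cone_point y) = lim_dist D (sval x) (sval y).
Proof. exact: cone_distE. Qed.

Lemma cvg_scaled x y : cvg (scaled_dist D (sval x) (sval y) @ w).
Proof. by apply: cvg_scaled_dist; exact: svalP. Qed.

Lemma mdist_cone_le x y C : (\forall n \near w, dist (term x n) (term y n) <= C * d n) ->
  mdist (cone_point x) (cone_point y) <= C.
Proof.
move=> xyC; rewrite mdist_cone; apply: limr_le; first exact: cvg_scaled.
near=> n; rewrite scaled_distE ler_pdivrMr; last by near: n; exact: scaling_gt0.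
by near: n.
Unshelve. all: by end_near. Qed.

Lemma mdist_cone_ge x y C : (\forall n \near w, C * d n <= dist (term x n) (term y n)) ->
  C <= mdist (cone_point x) (cone_point y).
Proof.
move=> xyC; rewrite mdist_cone; apply: limr_ge; first exact: cvg_scaled.
near=> n; rewrite scaled_distE ler_pdivlMr; last by near: n; exact: scaling_gt0.
by near: n.
Unshelve. all: by end_near. Qed.

Lemma mdist_cone_lt x y C : mdist (cone_point x) (cone_point y) < C ->
  \forall n \near w, dist (term x n) (term y n) < C * d n.
Proof.
rewrite mdist_cone => /(cvgr_lt _ (@cvg_scaled x y)) xyC.
near=> n; rewrite -ltr_pdivrMr; last by near: n; exact: scaling_gt0.
by rewrite -scaled_distE; near: n.
Unshelve. all: by end_near. Qed.

Lemma mdist_cone_gt x y C : C < mdist (cone_point x) (cone_point y) ->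
  \forall n \near w, C * d n < dist (term x n) (term y n).
Proof.
rewrite mdist_cone => /(cvgr_gt _ (@cvg_scaled x y)) xyC.
near=> n; rewrite -ltr_pdivlMr; last by near: n; exact: scaling_gt0.
by rewrite -scaled_distE; near: n.
Unshelve. all: by end_near. Qed.

Lemma mdist_cone_mono x y x' y' :
  (\forall n \near w, dist (term x n) (term y n) <= dist (term x' n) (term y' n)) ->
  mdist (cone_point x) (cone_point y) <= mdist (cone_point x') (cone_point y').
Proof.
move=> H; rewrite !mdist_cone; apply: ler_lim; [exact: cvg_scaled..|].
near=> n; rewrite !scaled_distE ler_pM2r; first by near: n.
by rewrite invr_gt0; near: n; exact: scaling_gt0.
Unshelve. all: by end_near. Qed.

Lemma cone_point_eq x y : (\forall n \near w, term x n = term y n) ->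
  cone_point x = cone_point y.
Proof.
move=> xy; apply/eqP; rewrite -[_ == _]negbK -mdist_gt0 -leNgt; apply: mdist_cone_le.
by apply: filterS xy => n ->; rewrite distxx mul0r.
Qed.

Lemma cone_point_surj a : exists x, cone_point x = a.
Proof. by exists (repr a); exact: cone_pointK. Qed.

Definition joined c : acone D -> acone D -> Prop := connected_component (~` [set c]).

Lemma joined_sym c a b : joined c a b -> joined c b a.
Proof. exact: connected_component_sym. Qed.

Lemma joined_trans c b a a' : joined c a b -> joined c b a' -> joined c a a'.
Proof. exact: connected_component_trans. Qed.

Lemma joined_not_separates c a b : joined c a b -> ~ separates c a b.
Proof.
move=> ab [_ _]; apply; apply/seteqP; split => z.
  by apply: connected_component_trans; exact: connected_component_sym.
exact: connected_component_trans.
Qed.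

Lemma truncn_dist (u v : R) : u <= v ->
  ((Num.truncn v)%:R - (Num.truncn u)%:R : R) <= v - u + 1.
Proof.
move=> uv; have [v0|v0] := lerP 0 v; last first.
  have tz (r : R) : r < 0 -> Num.truncn r = 0%N.
    by move=> r0; apply/truncn0Pn; rewrite -ltNge (lt_trans r0).
  rewrite !tz // ?(le_lt_trans uv) // subrr; lra.
have /andP[tv _] := truncn_itv v0; have := truncnS_gt u; rewrite -natr1; lra.
Qed.

(** Rescaling the time along the words by [d] turns them into a Lipschitz path in
    the cone, so that its image is connected. *)
Lemma path_joined x y c (s : nat -> word G) C :
    0 <= C -> (\forall n \near w, (size (s n))%:R <= C * d n) ->
    (\forall n \near w, term y n = vert (term x n) (s n) (size (s n))) ->
    (forall z (k : nat -> nat),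
       (\forall n \near w, term z n = vert (term x n) (s n) (k n)) ->
       cone_point z <> c) ->
  joined c (cone_point x) (cone_point y).
Proof.
move=> C0 sC yE avoid.
pose f t n := vert (term x n) (s n) (Num.truncn (t * d n)).
have f_dist t t' n : t <= t' -> 0 <= d n ->
    dist (f t n) (f t' n) <= (t' - t) * d n + 1.
  move=> tt' d0; have td : t * d n <= t' * d n by rewrite ler_wpM2r.
  have := truncn_dist td; rewrite -mulrBl; apply: le_trans.
  have tt := le_truncn td; rewrite -natrB // /dist ler_nat; exact: dist_vert.
have f0 n : f 0 n = term x n.
  by rewrite /f mul0r truncn0 /vert take0 raag_word_nil mulg1.
have f_adm t : admissible D (f t).
  apply: (@admissible_near x _ (`|t| + 1)); near=> n.
  have d1 : 1 <= d n by near: n; exact: scaling_ge.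
  rewrite -f0; apply: (@le_trans _ _ (`|t| * d n + 1)); last by rewrite mulrDl; lra.
  have [t0|t0] := lerP 0 t.
    apply: le_trans (f_dist _ _ _ _ _) _ => //; first lra.
    by rewrite subr0 ger0_norm.
  rewrite dist_sym; apply: le_trans (f_dist _ _ _ _ _) _; [exact: ltW|lra|].
  by rewrite sub0r ltr0_norm.
pose p t : acone D := cone_point (exist _ (f t) (f_adm t) : admissible_seq D).
have p_dist t t' : t <= t' -> mdist (p t) (p t') <= t' - t.
  move=> tt'; apply/ler_addgt0Pr => e e0; apply: mdist_cone_le; near=> n.
  have d0 : 0 < d n by near: n; exact: scaling_gt0.
  have de : e^-1 <= d n by near: n; exact: scaling_ge.
  apply: le_trans (f_dist _ _ _ tt' (ltW d0)) _; rewrite [leRHS]mulrDl lerD2l.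
  by rewrite -ler_pdivrMl // mulr1.
have p_cont : continuous p.
  move=> t; apply/metricType_numDomainType.cvgrPdist_le => e e0; near=> t'.
  have : `|t - t'| <= e by near: t'; exact: cvgr_dist_le.
  have [tt'|/ltW tt'] := lerP t t'.
    by apply: le_trans; exact: p_dist.
  by apply: le_trans; rewrite metric_sym; exact: p_dist.
have p0 : p 0 = cone_point x by apply: cone_point_eq; near=> n; exact: f0.
have pC : p C = cone_point y.
  apply: cone_point_eq; near=> n.
  have -> : term y n = vert (term x n) (s n) (size (s n)) by near: n.
  rewrite {1}/term /= /f /vert !take_oversize // truncn_ge_nat.
    by near: n.
  by rewrite mulr_ge0 //; near: n; apply: filterS (scaling_gt0 D) => n /ltW.
have conn : connected (p @` `[0, C]).
  apply: connected_continuous_connected; first exact: segment_connected.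
  exact: continuous_subspaceT.
rewrite -p0 -pC; apply: (@connected_component_max _ _ (p @` `[0, C]) (p 0)) conn _ _.
- by exists 0 => //; rewrite /= in_itv /= lexx.
- move=> _ [t _ <-]; apply: avoid; apply: filterE => n; reflexivity.
- by exists C => //; rewrite /= in_itv /= C0 lexx.
Unshelve. all: by end_near. Qed.

End Cone.

(** * Cosets of special subgroups in the cone *)

Section JoinCosets.
Context {R : realType} {G : sgraph} (D : cone_data R (cayley R G)).
Local Notation w := (cone_filter D).
Local Notation d := (scaling D).
Local Open Scope classical_set_scope.
Local Open Scope ring_scope.
Implicit Types (x y z o : admissible_seq D) (c a b : acone D) (g h : nat -> raag G)
  (C M eps : R) (T : pred G) (n k : nat).

(** Pointwise choice along the ultrafilter; the default value takes care of the
    indices outside of the large set. *)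
Lemma near_choice (T : Type) (t0 : T) (P : nat -> T -> Prop) :
  (\forall n \near w, exists t, P n t) -> exists f, \forall n \near w, P n (f n).
Proof.
move=> exP; have [n|f fP] := boolp.choice (P := fun n t => (exists t, P n t) -> P n t).
  by have [[t Pt]|nP] := pselect (exists t, P n t); [exists t|exists t0].
by exists f; apply: filterS exP => n; exact: fP.
Qed.

Lemma mulr_admissible x g C :
    (\forall n \near w, dist 1%g (g n) <= C * d n) ->
  exists z, forall n, term z n = (term x n * g n)%g.
Proof.
move=> gC; have adm : admissible D (fun n => (term x n * g n)%g : cayley R G).
  apply: (@admissible_near _ _ _ x _ C); apply: filterS gC => n.
  by rewrite /dist -{1}[term x n]mulg1 cayley_distM.
by exists (exist _ _ adm).
Qed.

Lemma dist_mul_bounded x y :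
  exists C, 0 <= C /\ \forall n \near w, dist (term x n) (term y n) <= C * d n.
Proof.
exists (mdist (cone_point x) (cone_point y) + 1); split.
  by rewrite addr_ge0 ?mdist_ge0.
have lt1 : mdist (cone_point x) (cone_point y) < mdist (cone_point x) (cone_point y) + 1.
  by rewrite ltrDl.
by apply: filterS (mdist_cone_lt lt1) => n /ltW.
Qed.

(** The point [y] lies in the limit of the cosets of the special subgroup [T]
    through [x]. *)
Definition in_coset T x y := \forall n \near w, special T ((term x n)^-1 * term y n)%g.

Lemma in_coset_refl T x : in_coset T x x.
Proof. by apply: filterE => n; rewrite mulVg; exact: special1. Qed.

Lemma in_coset_sym T x y : in_coset T x y -> in_coset T y x.
Proof.
by apply: filterS => n /specialV; rewrite invgM invgK.
Qed.

Lemma in_coset_trans T y x z : in_coset T x y -> in_coset T y z -> in_coset T x z.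
Proof.
move=> xy yz; near=> n; rewrite -[term z n](mulVKg (term y n)) mulgA.
by apply: specialM; near: n.
Unshelve. all: by end_near. Qed.

Lemma in_coset_sub (T T' : pred G) x y : (forall v, T v -> T' v) ->
  in_coset T x y -> in_coset T' x y.
Proof. by move=> TT; apply: filterS => n; exact: special_sub. Qed.

Definition coset_hits T c x := exists2 z, in_coset T x z & cone_point z = c.

Lemma coset_hits_trans T c x y : in_coset T x y -> coset_hits T c y -> coset_hits T c x.
Proof. by move=> xy [z yz zc]; exists z => //; exact: in_coset_trans yz. Qed.

(** A coset is geodesically connected, so the path between two of its points meets
    [c] only if the coset does. *)
Lemma coset_joined T c x y : in_coset T x y -> ~ coset_hits T c x ->
  joined c (cone_point x) (cone_point y).
Proof.
move=> xy nh; have [C [C0 xyC]] := dist_mul_bounded x y.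
have [|s sP] := @near_choice (word G) [::] (fun n s =>
    [/\ term y n = (term x n * raag_word s)%g,
        size s = cayley_dist (term x n) (term y n) & all (fun l => T l.1) s]).
  by apply: filterS xy => n /special_geodesic[s [sE ss _ Ts]]; exists s.
apply: (@path_joined _ _ _ x y c s C) => //.
- near=> n; have [_ -> _] : [/\ term y n = (term x n * raag_word (s n))%g,
    size (s n) = cayley_dist (term x n) (term y n) & all (fun l => T l.1) (s n)].
    by near: n.
  by near: n.
- by apply: filterS sP => n [-> _ _]; rewrite /vert take_size.
move=> z k zE zc; apply: nh; exists z => //; near=> n.
have -> : term z n = vert (term x n) (s n) (k n) by near: n.
have [_ _ Ts] : [/\ term y n = (term x n * raag_word (s n))%g,
    size (s n) = cayley_dist (term x n) (term y n) & all (fun l => T l.1) (s n)].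
  by near: n.
rewrite /vert mulKg; exists (take (k n) (s n)) => //.
by apply/allP => l /mem_take; exact: (allP Ts).
Unshelve. all: by end_near. Qed.

Lemma cosets_mdist (T T' : pred G) x x' y y' : (forall v, T v -> ~~ T' v) ->
    in_coset T x y -> in_coset T x' y' -> in_coset T' x x' ->
  mdist (cone_point x) (cone_point x') <= mdist (cone_point y) (cone_point y').
Proof.
move=> TT' xy xy' xx'; apply: mdist_cone_mono; near=> n.
by rewrite ler_nat; apply: (retraction_dist_coset TT'); near: n.
Unshelve. all: by end_near. Qed.

Lemma mdist_le0 a b : mdist a b <= 0 -> a = b.
Proof. by move=> ab; apply/eqP; rewrite -[_ == _]negbK -mdist_gt0 -leNgt. Qed.

(** Parallel cosets which meet in the cone have the same position transversally. *)
Lemma parallel_hits (T T' : pred G) c x x' : (forall v, T v -> ~~ T' v) ->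
    in_coset T' x x' -> coset_hits T c x -> coset_hits T c x' ->
  cone_point x = cone_point x'.
Proof.
move=> TT' xx' [y xy yc] [y' xy' yc']; apply: mdist_le0.
by apply: le_trans (cosets_mdist TT' xy xy' xx') _; rewrite yc yc' mdistxx.
Qed.

(** The limits of the two cosets through [x] only meet in [x]. *)
Lemma transverse_hits (T T' : pred G) c x : (forall v, T v -> ~~ T' v) ->
  coset_hits T c x -> coset_hits T' c x -> cone_point x = c.
Proof.
move=> TT' [y xy yc] [y' xy' yc']; rewrite -yc'; apply: mdist_le0.
apply: le_trans (cosets_mdist TT' xy (in_coset_refl T y') xy') _.
by rewrite yc yc' mdistxx.
Qed.

(** The powers of [v] give a point at distance 1 from [x]. *)
Lemma ray_point x v : exists2 z,
  (forall n, term z n = (term x n * gen v ^+ Num.truncn (d n))%g) &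
  cone_point z <> cone_point x.
Proof.
have [|z zE] := @mulr_admissible x (fun n => gen v ^+ Num.truncn (d n))%g 1.
  near=> n; rewrite /dist dist_pow mul1r truncn_le.
  by apply/ltW; near: n; exact: scaling_gt0.
exists z => // zx; have : 2^-1 <= mdist (cone_point x) (cone_point z).
  apply: mdist_cone_ge; near=> n; rewrite zE /dist.
  rewrite -{1}[term x n]mulg1 cayley_distM dist_pow.
  have d2 : 2 <= d n by near: n; exact: scaling_ge.
  have := truncnS_gt (d n); rewrite -natr1; lra.
by rewrite zx mdistxx; lra.
Unshelve. all: by end_near. Qed.

Lemma ray_in_coset T x v z : T v ->
  (forall n, term z n = (term x n * gen v ^+ Num.truncn (d n))%g) -> in_coset T x z.
Proof.
move=> Tv zE; apply: filterE => n; rewrite zE mulKg.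
elim: (Num.truncn (d n)) => [|k IHk]; first by rewrite expg0; exact: special1.
by rewrite expgS; apply: specialM IHk; exists [:: (v, true)]; rewrite //= Tv.
Qed.

(** At most one of the cosets of [T] through two different points of a coset of
    [T'] contains [c], and moving by a power of [v] provides a second point. *)
Lemma avoiding_coset (T T' : pred G) c x v : (forall u, T u -> ~~ T' u) -> T' v ->
  exists2 z, in_coset T' x z & ~ coset_hits T c z.
Proof.
move=> TT' T'v; have [h|] := pselect (coset_hits T c x); last first.
  by move=> nh; exists x => //; exact: in_coset_refl.
have [z zE zx] := ray_point x v; have xz := ray_in_coset T'v zE.
by exists z => // h'; apply: zx; rewrite (parallel_hits TT' xz h h').
Qed.

(** In a product, first change the first coordinate from that of [z] to that of
    [x1] inside a fibre without [c], then the second coordinate inside the fibre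
    through [x1], which does not contain [c] either. *)
Lemma product_joined (T1 T2 : pred G) c x x1 o z :
    (forall u v, T1 u -> T2 v -> edge u v) ->
    in_coset (fun v => T1 v || T2 v) x z -> in_coset T1 x x1 -> in_coset T2 x1 o ->
    ~ coset_hits T2 c x1 -> ~ coset_hits T1 c z ->
  joined c (cone_point z) (cone_point o).
Proof.
move=> T12 xz xx1 x1o h1 hz; have disj v : T1 v -> ~~ T2 v.
  by move=> T1v; apply/negP => T2v; have := T12 v v T1v T2v; rewrite edge_irr.
have [|q qP] := @near_choice (raag G) 1%g (fun n q =>
    exists p, [/\ special T1 p, special T2 q & (term x n)^-1 * term z n = p * q]%g).
  by apply: filterS xz => n /(special_product T12)[p [q pq]]; exists q, p.
have [C [C0 xzC]] := dist_mul_bounded x z.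
have [|z' z'E] := @mulr_admissible x1 q C.
  near=> n; have [p [Tp Tq E]] : exists p, [/\ special T1 p, special T2 (q n) &
    (term x n)^-1 * term z n = p * q n]%g by near: n.
  have : dist (term x n) (term z n) <= C * d n by near: n.
  apply: le_trans; rewrite ler_nat.
  rewrite -(cayley_distM (term x n)^-1%g (term x n)) mulVg E -[(p * _)%g]mulg1.
  by apply: (retraction_dist disj) => //; exact: special1.
have x1z' : in_coset T2 x1 z'.
  by apply: filterS qP => n [p [_ Tq _]]; rewrite z'E mulKg.
have zz' : in_coset T1 z z'.
  near=> n; have [p [Tp Tq E]] : exists p, [/\ special T1 p, special T2 (q n) &
    (term x n)^-1 * term z n = p * q n]%g by near: n.
  have Tx : special T1 ((term x n)^-1 * term x1 n)%g by near: n.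
  set r := (p^-1 * ((term x n)^-1 * term x1 n))%g.
  have Tr : special T1 r by apply: specialM => //; exact: specialV.
  have z'r : term z' n = (term x n * p * (r * q n))%g.
    by rewrite z'E /r -!mulgA mulVKg mulVKg.
  have -> : ((term z n)^-1 * term z' n = r)%g; last by [].
  rewrite z'r (special_commute T12 Tr Tq) -[term z n](mulVKg (term x n)) E.
  by rewrite invgM -!mulgA mulKg invgM -!mulgA !mulKg.
apply: (joined_trans (coset_joined zz' hz)).
apply: coset_joined (in_coset_trans (in_coset_sym x1z') x1o) _.
by move=> /(coset_hits_trans x1z').
Unshelve. all: by end_near. Qed.

End JoinCosets.

(** * Finite join length rules out separation *)

Section JoinChains.
Context {R : realType} {G : sgraph} (D : cone_data R (cayley R G)).
Local Notation w := (cone_filter D).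
Local Notation d := (scaling D).
Local Open Scope classical_set_scope.
Local Open Scope ring_scope.
Implicit Types (x y z o : admissible_seq D) (c a b : acone D) (g h : nat -> raag G)
  (C M eps : R) (T : pred G) (n k : nat) (J : {set G}).

(** The limit of a coset of a join subgroup is a product of two connected spaces
    with more than one point.  Choose a fibre of either kind that misses [c]; they
    meet in [o].  Every point other than [c] has a fibre that misses [c], and it
    leads to one of the two chosen fibres, hence to [o]. *)
Lemma join_joined J c x y : is_join J -> in_coset (mem J) x y ->
  cone_point x <> c -> cone_point y <> c -> joined c (cone_point x) (cone_point y).
Proof.
move=> [J1 [J2 [/set0Pn[v1 v1J] /set0Pn[v2 v2J] _ JE E]]] xy xc yc.
have E1 u v : mem J1 u -> mem J2 v -> edge u v by exact: E.
have E2 u v : mem J2 u -> mem J1 v -> edge u v by move=> uJ vJ; rewrite edge_sym E.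
have d1 v : mem J1 v -> ~~ mem J2 v.
  by move=> vJ; apply/negP => /(E1 _ _ vJ); rewrite edge_irr.
have d2 v : mem J2 v -> ~~ mem J1 v.
  by move=> vJ; apply/negP => /(E2 _ _ vJ); rewrite edge_irr.
have [x1 xx1 nh1] := @avoiding_coset _ _ _ _ _ c x v1 d2 v1J.
have [x2 xx2 nh2] := @avoiding_coset _ _ _ _ _ c x v2 d1 v2J.
have [C [_ xx2C]] := dist_mul_bounded x x2.
have [|o oE] := @mulr_admissible _ _ _ x1 (fun n => (term x n)^-1 * term x2 n)%g C.
  near=> n; rewrite -(mulVg (term x n)) /dist cayley_distM.
  by have : dist (term x n) (term x2 n) <= C * d n by near: n.
have x1o : in_coset (mem J2) x1 o by apply: filterS xx2 => n; rewrite oE mulKg.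
have x2o : in_coset (mem J1) x2 o.
  near=> n; have T1 : special (mem J1) ((term x n)^-1 * term x1 n)%g by near: n.
  have T2 : special (mem J2) ((term x n)^-1 * term x2 n)%g by near: n.
  have -> : ((term x2 n)^-1 * term o n = (term x n)^-1 * term x1 n)%g; last by [].
  have E12 := special_commute E1 T1 T2.
  rewrite oE -{1}[term x1 n](mulVKg (term x n)) -{1}[term x2 n](mulVKg (term x n)).
  move: (_^-1 * term x1 n)%g (_^-1 * term x2 n)%g E12 => p q E12.
  by rewrite invgM -!mulgA mulKg E12 mulKg.
have all_joined z : in_coset (mem J) x z -> cone_point z <> c ->
    joined c (cone_point z) (cone_point o).
  move=> xz zc; have [h|h] := pselect (coset_hits (mem J1) c z).
    apply: (product_joined E2 _ xx2 x2o nh2); last first.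
      by move=> h'; apply: zc; exact: transverse_hits d1 h h'.
    by apply: in_coset_sub xz => v; rewrite JE /= inE orbC.
  apply: (product_joined E1 _ xx1 x1o nh1 h).
  by apply: in_coset_sub xz => v; rewrite JE /= inE.
apply: (joined_trans (all_joined x (in_coset_refl _ _) xc)).
exact/joined_sym/all_joined.
Unshelve. all: by end_near. Qed.

(** If the two cosets touch only in [c], one walks around [c]: rays from [c] in
    the directions of adjacent vertices lie in the coset of the join formed by these
    two vertices, and the graph is connected. *)
Lemma wedge_joined J J' c x u u' : connected_graph G -> is_join J -> is_join J' ->
    in_coset (mem J) x u -> in_coset (mem J') x u' ->
    cone_point u <> c -> cone_point u' <> c ->
  joined c (cone_point u) (cone_point u').
Proof.
move=> Gc Jj Jj' xu xu' uc uc'; have [xc|xc] := pselect (cone_point x = c); last first.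
  apply: (@joined_trans _ _ _ _ (cone_point x)); last exact: join_joined xu' xc uc'.
  exact/joined_sym/(join_joined Jj xu).
have ray v : exists2 z,
    (forall n, term z n = (term x n * gen v ^+ Num.truncn (d n))%g) & cone_point z <> c.
  by rewrite -xc; exact: ray_point.
have nonempty J0 : is_join J0 -> exists v, v \in J0.
  by move=> [J1 [J2 [/set0Pn[v vJ] _ _ -> _]]]; exists v; rewrite inE vJ.
have [v vJ] := nonempty J Jj; have [v' vJ'] := nonempty J' Jj'.
have [z zE zc] := ray v; have [z' zE' zc'] := ray v'.
have uz : joined c (cone_point u) (cone_point z).
  apply: join_joined uc zc => //; first exact: Jj.
  apply: in_coset_trans (in_coset_sym xu) _; exact: (ray_in_coset vJ zE).
have uz' : joined c (cone_point z') (cone_point u').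
  apply: join_joined zc' uc' => //; first exact: Jj'.
  apply: in_coset_trans xu'; apply: in_coset_sym; exact: (ray_in_coset vJ' zE').
apply: (joined_trans uz); apply: joined_trans uz'.
have /connectP[p vp lp] := Gc v v'; clear u u' xu xu' uc uc' uz vJ vJ'.
elim: p v z zE zc vp lp => [|v1 p IHp] v z zE zc /= vp lp.
  have -> : cone_point z' = cone_point z.
    by apply: cone_point_eq; apply: filterE => n; rewrite zE zE' lp.
  exact: connected_component_refl.
case/andP: vp => vv1 vp; have [z1 zE1 zc1] := ray v1.
apply: (joined_trans _ (IHp v1 z1 zE1 zc1 vp lp)).
apply: (join_joined (edge_is_join vv1)) => //.
apply: (@in_coset_trans _ _ _ _ x).
  by apply: in_coset_sym; apply: ray_in_coset zE; rewrite /= !inE eqxx.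
by apply: ray_in_coset zE1; rewrite /= !inE eqxx orbT.
Qed.

(** An ultrafilter picks one part of a finite partition. *)
Lemma ultra_pigeonhole (I : finType) (P : I -> nat -> Prop) :
  (\forall n \near w, exists i, P i n) -> exists i, \forall n \near w, P i n.
Proof.
move=> exP; apply: contrapT => /forallNP nP.
have all_n : \forall n \near w, forall i, ~ P i n.
  apply: filter_forall => i; have [/nP//|] := in_ultra_setVsetC [set n | P i n] (cone_filter_ultra D).
  exact: filterS.
by have [n [[i Pi] /(_ i)]] := filter_ex (filterI exP all_n).
Qed.

(** Induction on the number of cosets in the chain.  The intermediate point where
    two cosets meet may be [c]; so the induction starts from any point [u] of a join
    coset through [x], and another point [u'] is chosen in the next coset. *)
Lemma chain_joined c y k C x u J : connected_graph G ->
    (\forall n \near w, exists ss, [/\ size ss = k,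
       term y n = (term x n * raag_word (flatten ss))%g,
       (size (flatten ss))%:R <= C * d n & forall s : word G, s \in ss -> join_word s]) ->
    is_join J -> in_coset (mem J) x u -> cone_point u <> c -> cone_point y <> c ->
  joined c (cone_point u) (cone_point y).
Proof.
move=> Gc; elim: k x u J => [|k IHk] x u J ch Jj xu uc yc.
  apply: (join_joined Jj) => //; near=> n.
  have [ss [/size0nil -> -> _ _]] : exists ss, [/\ size ss = 0%N,
       term y n = (term x n * raag_word (flatten ss))%g,
       (size (flatten ss))%:R <= C * d n & forall s : word G, s \in ss -> join_word s].
    by near: n.
  rewrite raag_word_nil mulg1 -[X in special _ X]invgK invgM invgK; apply: specialV.
  by near: n.
have [|s1 s1P] := @near_choice _ _ D (word G) [::] (fun n s1 => exists ss,
    [/\ size ss = k, term y n = (term x n * raag_word s1 * raag_word (flatten ss))%g,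
     (size s1)%:R <= C * d n, (size (flatten ss))%:R <= C * d n &
     join_word s1 /\ forall s : word G, s \in ss -> join_word s]).
  apply: filterS ch => n [[|s1 ss] [//= [ssk] yE sC ssJ]]; exists s1, ss; split => //.
  - by rewrite yE raag_word_cat mulgA.
  - by apply: le_trans sC; rewrite ler_nat size_cat leq_addr.
  - by apply: le_trans sC; rewrite ler_nat size_cat leq_addl.
  - split; first exact/ssJ/mem_head.
    by move=> s sss; apply: ssJ; rewrite inE sss orbT.
have [|x' xE'] := @mulr_admissible _ _ _ x (fun n => raag_word (s1 n)) C.
  apply: filterS s1P => n [ss [_ _ sC _ _]]; apply: le_trans sC; rewrite ler_nat.
  by rewrite -[raag_word _]mul1g cayley_dist_le_size.
have [|J1 J1P] := @ultra_pigeonhole {set G} (fun J1 n =>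
    is_join J1 /\ all (fun l => l.1 \in J1) (s1 n)).
  by apply: filterS s1P => n [ss [_ _ _ _ [[J1 J1j J1s] _]]]; exists J1.
have [_ [J1j _]] := filter_ex J1P.
have xx' : in_coset (mem J1) x x'.
  by apply: filterS J1P => n [_ sJ]; rewrite xE' mulKg; exists (s1 n).
have [u' xu' uc'] : exists2 u', in_coset (mem J1) x' u' & cone_point u' <> c.
  have [xc|xc] := pselect (cone_point x' = c); last first.
    by exists x' => //; exact: in_coset_refl.
  case: (J1j) => [K1 [K2 [/set0Pn[v vK] _ _ KE _]]].
  have [u' uE' uc'] := ray_point x' v; exists u'; last by rewrite -xc.
  by apply: ray_in_coset uE'; rewrite /= KE inE vK.
have xu1 := in_coset_trans xx' xu'.
apply: (joined_trans (wedge_joined Gc Jj J1j xu xu1 uc uc')).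
apply: (IHk x' u' J1) => //.
by apply: filterS s1P => n [ss [ssk yE _ sC [_ ssJ]]]; exists ss; rewrite xE'.
Unshelve. all: by end_near. Qed.

(** A geodesic from [x] stays within the distance of its ends. *)
Lemma close_joined c x y :
    mdist (cone_point x) (cone_point y) < mdist (cone_point x) c ->
  joined c (cone_point x) (cone_point y).
Proof.
move=> xyc; have [C [C0 xyC]] := dist_mul_bounded x y.
have /boolp.choice[s sP] n : exists s, [/\ term y n = (term x n * raag_word s)%g,
    size s = cayley_dist (term x n) (term y n) & geodesic s] by exact: geodesic_exists.
apply: (@path_joined _ _ _ x y c s C) => //.
- by apply: filterS xyC => n; have [_ -> _] := sP n.
- by apply: filterE => n; rewrite /vert take_size; have [] := sP n.
move=> z k zE zc; move: xyc; rewrite -zc ltNge => /negP; apply.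
apply: mdist_cone_mono; apply: filterS zE => n ->; rewrite ler_nat.
have [_ <- _] := sP n; rewrite /vert; apply: leq_trans (cayley_dist_le_size _ _) _.
by rewrite size_take_min geq_minr.
Qed.

Lemma finite_join_length_joined c a b : connected_graph G -> finite_join_length a b ->
  a <> c -> b <> c -> joined c a b.
Proof.
move=> Gc [x [y [<- <- /ultra_lim_ltey_bounded[M xyM]]]] ac bc.
have [k kP] : exists k : 'I_(Num.truncn M).+2, \forall n \near w,
    join_expressible ((term x n)^-1 * term y n)%g k.
  apply: ultra_pigeonhole; apply: filterS xyM => n /= jM.
  have : (join_length R ((term x n)^-1 * term y n)%g < (M + 1)%:E)%E.
    by apply: le_lt_trans jM _; rewrite lte_fin ltrDl.
  move=> /ereal_inf_lt[_ [k kE <-]]; rewrite lte_fin => kM.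
  have kS : (k < (Num.truncn M).+2)%N.
    rewrite -(ltr_nat R) (lt_le_trans kM) // -[X in _ <= X]natr1 lerD2r.
    exact/ltW/truncnS_gt.
  by exists (Ordinal kS).
have [C [C0 xyC]] := dist_mul_bounded x y.
have ch : \forall n \near w, exists ss, [/\ size ss = k,
    term y n = (term x n * raag_word (flatten ss))%g,
    (size (flatten ss))%:R <= C * d n & forall s : word G, s \in ss -> join_word s].
  near=> n; have : join_expressible ((term x n)^-1 * term y n)%g k by near: n.
  case/join_expressible_words => ss [ssk ssE ssg ssJ].
  have yE : term y n = (term x n * raag_word (flatten ss))%g by rewrite -ssE mulVKg.
  exists ss; split => //; have : dist (term x n) (term y n) <= C * d n by near: n.
  by rewrite /dist yE geodesic_dist.
have [n [[|s ss] [ssk yE sC ssJ]]] := filter_ex ch.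
  have -> : cone_point y = cone_point x.
    apply: cone_point_eq; apply: filterS ch => m [[|? ?] []]; rewrite -ssk //.
    by move=> _ ->; rewrite raag_word_nil mulg1.
  exact: connected_component_refl.
have [J Jj _] := ssJ s (mem_head _ _).
exact: (chain_joined Gc ch Jj (in_coset_refl _ _)).
Unshelve. all: by end_near. Qed.

Lemma approximable_not_separated a b c : connected_graph G ->
    (forall eps : R, 0 < eps -> exists a' b' : acone D,
       [/\ mdist a a' <= eps, mdist b b' <= eps & finite_join_length a' b']) ->
  ~ separates c a b.
Proof.
move=> Gc ab sep; have [ac bc _] := sep; move: sep; apply: joined_not_separates.
have near_c a0 : a0 <> c -> exists2 e, 0 < e & forall a1, mdist a0 a1 <= e ->
    joined c a0 a1 /\ a1 <> c.
  move=> /eqP; rewrite -mdist_gt0 => a0c; exists (mdist a0 c / 2) => [|a1 a01]; first lra.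
  have lt1 : mdist a0 a1 < mdist a0 c by lra.
  split; last by move=> a1c; rewrite a1c ltxx in lt1.
  have [x xE] := cone_point_surj a0; have [y yE] := cone_point_surj a1.
  by rewrite -xE -yE in lt1 *; exact: close_joined.
have [e1 e10 H1] := near_c a ac; have [e2 e20 H2] := near_c b bc.
have [|a' [b' [aa' bb' fab]]] := ab (Num.min e1 e2); first by rewrite lt_min e10.
move: aa' bb'; rewrite !le_min => /andP[/H1[ja ac'] _] /andP[_ /H2[jb bc']].
apply: (joined_trans ja); apply: joined_trans (joined_sym jb).
exact: finite_join_length_joined.
Qed.

End JoinChains.

(** * Unbounded join length produces a cut point *)

Section CutPoints.
Context {R : realType} {G : sgraph} (D : cone_data R (cayley R G)).
Local Notation w := (cone_filter D).
Local Notation d := (scaling D).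
Local Open Scope classical_set_scope.
Local Open Scope ring_scope.
Implicit Types (x y z : admissible_seq D) (c a b : acone D) (g h : nat -> raag G)
  (C M eps : R) (T : pred G) (n k m : nat).

(** A nonprincipal ultrafilter contains the cofinite sets. *)
Lemma near_ge_nat m : \forall n \near w, (m <= n)%N.
Proof.
elim: m => [|m IHm]; first exact: filterE.
have : \forall n \near w, n <> m.
  by have [/cone_filter_nonprincipal//|] := in_ultra_setVsetC [set m] (cone_filter_ultra D).
move=> nm; apply: filterS (filterI IHm nm) => n /= [mn nm'].
by rewrite ltn_neqAle mn andbT eq_sym; apply/eqP.
Qed.

(** Take the largest [m] not exceeding [n] that is possible at the index [n]. *)
Lemma near_diagonal (P : nat -> nat -> Prop) : (forall m, \forall n \near w, P m n) ->
  exists f : nat -> nat, (forall m, \forall n \near w, (m <= f n)%N) /\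
    \forall n \near w, P (f n) n.
Proof.
move=> HP; have /boolp.choice[f fP] n : exists f, forall m, (m <= n)%N -> P m n ->
    (m <= f)%N /\ P f n.
  have [ex|nex] := pselect (exists m, (m <= n)%N && `[< P m n >]); last first.
    exists 0%N => m mn Pm; exfalso; apply: nex; exists m; rewrite mn; exact/asboolP.
  have bd m : (m <= n)%N && `[< P m n >] -> (m <= n)%N by case/andP.
  case: (ex_maxnP ex bd) => f /andP[_ /asboolP Pf] fmax.
  exists f => m mn Pm; split => //; apply: fmax; rewrite mn; exact/asboolP.
exists f; split.
  move=> m; apply: filterS (filterI (HP m) (near_ge_nat m)) => n [Pm mn].
  by have [] := fP n m mn Pm.
by apply: filterS (HP 0%N) => n P0; have [] := fP n 0%N (leq0n n) P0.
Qed.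

Lemma join_length_ge0 (g : raag G) : (0 <= join_length R g)%E.
Proof. by apply: le_ereal_inf_tmp => _ [k _ <-]; rewrite lee_fin. Qed.

Lemma join_length1 : (join_length R (1%g : raag G) <= 0)%E.
Proof.
apply: ereal_inf_lbound; exists 0%N => //.
by exists [::]; rewrite big_nil.
Qed.

Lemma bounded_finite_join_length x y M :
    (\forall n \near w, (join_length R ((term x n)^-1 * term y n)%g <= M%:E)%E) ->
  finite_join_length (cone_point x) (cone_point y).
Proof.
move=> xyM; exists x, y; split => //; apply: (@ultra_lim_lty _ _ _ _ M).
by apply: filterS xyM => n xyMn; rewrite join_length_ge0.
Qed.

(** If the graph has an edge, every letter lies in a join subgroup.  Otherwise the
    number of factors bounds the distance, and both sequences give the same point. *)
Lemma factorable_finite_join_length x y k : connected_graph G ->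
    (\forall n \near w, factorable k ((term x n)^-1 * term y n)%g) ->
  finite_join_length (cone_point x) (cone_point y).
Proof.
move=> Gc xyk; have [E|nE] := pselect (exists u v : G, edge u v).
  apply: (@bounded_finite_join_length _ _ k%:R); apply: filterS xyk => n.
  exact/factorable_join_length/connected_neighbour.
have -> : cone_point y = cone_point x.
  apply/esym/mdist_le0/ler_addgt0Pr => e e0; rewrite add0r; apply: mdist_cone_le.
  near=> n; have : factorable k ((term x n)^-1 * term y n)%g by near: n.
  move/(factorable_dist nE); rewrite -(mulVg (term x n)) cayley_distM -(ler_nat R).
  move/le_trans; apply; rewrite -ler_pdivrMl // mulrC.
  by near: n; exact: scaling_ge.
apply: (@bounded_finite_join_length _ _ 0); apply: filterE => n.
by rewrite mulVg; exact: join_length1.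
Unshelve. all: by end_near. Qed.

(** The number of walls that have been passed is locally bounded away from [z]:
    nearby points of the cone at distance [r] from the limit of [z] cannot be
    separated by two consecutive walls, as this would cost a detour of length about
    [2 * r].  So the points on the starting side of a wall of bounded index form a
    set [V] that is open and closed in the complement of the limit of [z]; it
    contains the first point, and not the second one. *)
Lemma barrier_separates x y z (m e : nat -> nat) :
    (forall k, \forall n \near w, (k <= m n)%N) ->
    (forall eps, 0 < eps -> \forall n \near w, (e n)%:R <= eps * d n) ->
    (\forall n \near w, barrier (term x n) (term y n) (term z n) (m n) (e n)) ->
    cone_point x <> cone_point z -> cone_point y <> cone_point z ->
  forall a b, repr a = x -> repr b = y -> separates (cone_point z) a b.
Proof.
move=> m_oo e_small bar xz yz a b ax by_.
have aE : a = cone_point x by rewrite -ax cone_pointK.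
have bE : b = cone_point y by rewrite -by_ cone_pointK.
set c := cone_point z.
have [|H HP] := @near_choice _ _ D (nat -> raag G -> bool) (fun _ _ => true)
    (fun n H => [/\ forall k, (k <= m n)%N -> H k (term x n),
      forall k, (k <= m n)%N -> ~~ H k (term y n) &
      forall k X Y, (k < m n)%N -> H k X -> ~~ H k.+1 Y ->
      (cayley_dist X (term z n) + cayley_dist (term z n) Y <= cayley_dist X Y + e n)%N]).
  by apply: filterS bar => n [H HP]; exists H.
pose V (p : acone D) := exists M : nat,
  \forall n \near w, exists2 k, (k <= M)%N & H n k (term (repr p) n).
have Va : V a.
  by exists 0%N; apply: filterS HP => n [Hx _ _]; exists 0%N => //; rewrite ax Hx.
have nVb : ~ V b.
  move=> [M bM]; have [n [[[_ Hy _] [k kM Hk]] mM]] := filter_ex (filterI (filterI HP bM) (m_oo M)).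
  by rewrite by_ in Hk; have := Hy k (leq_trans kM mM); rewrite Hk.
have Vnear p q : mdist p q < mdist p c / 2 -> p <> c -> V p -> V q.
  move=> pq pc [M pM]; exists M.+1.
  have pc0 : 0 < mdist p c by rewrite mdist_gt0; exact/eqP.
  have pq_n : \forall n \near w, dist (term (repr p) n) (term (repr q) n) < (mdist p c / 2) * d n.
    by apply: mdist_cone_lt; rewrite !cone_pointK.
  have pc_n : \forall n \near w, (mdist p c * (3 / 4)) * d n < dist (term (repr p) n) (term z n).
    by apply: mdist_cone_gt; rewrite cone_pointK -/c; lra.
  have e_n : \forall n \near w, (e n)%:R <= (mdist p c / 4) * d n.
    by apply: e_small; lra.
  near=> n; have [k kM Hk] : exists2 k, (k <= M)%N & H n k (term (repr p) n) by near: n.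
  exists k.+1 => //; apply/negPn/negP => Hq.
  have [_ _ /(_ k _ _ _ Hk Hq) B] : [/\ forall k, (k <= m n)%N -> H n k (term x n),
      forall k, (k <= m n)%N -> ~~ H n k (term y n) &
      forall k X Y, (k < m n)%N -> H n k X -> ~~ H n k.+1 Y ->
      (cayley_dist X (term z n) + cayley_dist (term z n) Y <= cayley_dist X Y + e n)%N]
    by near: n.
  have mM : (M.+1 <= m n)%N by near: n; exact: m_oo.
  move: (B (leq_ltn_trans kM mM)); rewrite -(ler_nat R) !natrD.
  have d0 : 0 < d n by near: n; exact: scaling_gt0.
  have pd0 : 0 < mdist p c * d n by rewrite mulr_gt0.
  have tri : (dist (term (repr p) n) (term z n) : R) <=
      dist (term (repr p) n) (term (repr q) n) + dist (term z n) (term (repr q) n).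
    by rewrite (dist_sym (term z n)); exact: dist_triangle.
  have H1 : dist (term (repr p) n) (term (repr q) n) < (mdist p c / 2) * d n by near: n.
  have H2 : (mdist p c * (3 / 4)) * d n < dist (term (repr p) n) (term z n) by near: n.
  have H3 : (e n)%:R <= (mdist p c / 4) * d n by near: n.
  move: tri H1 H2; rewrite /dist; lra.
have Vball p : p <> c -> exists2 r, 0 < r & forall q, mdist p q < r ->
    [/\ q <> c, V p -> V q & V q -> V p].
  move=> pc; have pc0 : 0 < mdist p c by rewrite mdist_gt0; exact/eqP.
  exists (mdist p c / 4); first lra.
  move=> q pq; have tri := metric_triangle p q c.
  have qc : q <> c by move=> qc; move: pq; rewrite qc; lra.
  split => //; first by apply: Vnear => //; lra.
  by apply: Vnear => //; rewrite metric_sym; lra.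
have openV (P : Prop -> Prop) : (forall Q Q' : Prop, (Q <-> Q') -> P Q -> P Q') ->
    open [set p | p <> c /\ P (V p)].
  move=> PQ; rewrite openE => p [pc Vp]; apply/nbhs_ballP.
  have [r r0 rP] := Vball p pc; exists r => // q; rewrite ballEmdist /= => /rP[qc V1 V2].
  by split => //; apply: PQ Vp.
split; rewrite ?aE ?bE // -aE -bE => E.
have : connected_component (~` [set c]) a b.
  by rewrite E; apply: connected_component_refl => /=; rewrite bE.
move=> [B [Ba Bc Bconn] Bb]; apply: nVb.
suff : B `&` V = B by move=> BV; have [] : (B `&` V) b by rewrite BV.
apply: Bconn; first by exists a.
  exists [set p | p <> c /\ V p]; first by apply: (openV id) => Q Q' [].
  by apply/seteqP; split => p [Bp] => [Vp|[_ Vp]]; split => //; split => //; exact: Bc.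
exists (~` [set p | p <> c /\ ~ V p]).
  apply: open_closedC; apply: (openV not) => Q Q' [H1 H2] nQ /H2 //.
apply/seteqP; split => p [Bp] => [Vp|nV]; split => //; first by case.
by apply: contrapT => nVp; apply: nV; split => //; exact: Bc.
Unshelve. all: by end_near. Qed.

(** Cut pieces of length [eps * d n] off both ends of a geodesic.  The rest cannot
    be a product of boundedly many factors, so it carries barriers of every order
    [m] with error [O(d n / m)].  A diagonal choice lets [m] tend to infinity; the
    pieces cut off keep the position of the barrier away from both ends. *)
Lemma not_separated_approximable a b : connected_graph G ->
    (forall c, ~ separates c a b) ->
  forall eps, 0 < eps -> exists a' b',
    [/\ mdist a a' <= eps, mdist b b' <= eps & finite_join_length a' b'].
Proof.
move=> Gc nsep eps eps0; apply: contrapT => nab.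
pose x := repr a; pose y := repr b.
have aE : a = cone_point x by rewrite cone_pointK.
have bE : b = cone_point y by rewrite cone_pointK.
have [C [C0 xyC]] := dist_mul_bounded x y.
have /boolp.choice[s sP] n : exists s, [/\ term y n = (term x n * raag_word s)%g,
    size s = cayley_dist (term x n) (term y n) & geodesic s] by exact: geodesic_exists.
pose N n := size (s n).
have NC : \forall n \near w, (N n)%:R <= C * d n.
  by apply: filterS xyC => n; rewrite /N; have [_ -> _] := sP n.
pose pt n := vert (term x n) (s n).
pose i n := minn (Num.truncn (eps * d n)) (N n).
(* The minimum and the maximum keep [i n <= l n <= N n] when the two pieces would
   overlap. *)
pose l n := maxn (i n) (N n - i n).
have iN n : (i n <= N n)%N by exact: geq_minr.
have il n : (i n <= l n)%N by exact: leq_maxl.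
have lN n : (l n <= N n)%N by rewrite geq_max iN leq_subr.
have pt0 n : pt n 0%N = term x n by rewrite /pt /vert take0 raag_word_nil mulg1.
have ptN n : pt n (N n) = term y n by rewrite /pt /vert take_size; have [] := sP n.
have d0 : \forall n \near w, 0 < d n by exact: scaling_gt0.
have i_le : \forall n \near w, (i n)%:R <= eps * d n.
  apply: filterS d0 => n dn; apply: (@le_trans _ _ (Num.truncn (eps * d n))%:R).
    by rewrite ler_nat geq_minl.
  by rewrite truncn_le mulr_ge0 // ltW.
have mkpoint (k : nat -> nat) : (forall n, (k n <= N n)%N) ->
    exists z : admissible_seq D, forall n, term z n = pt n (k n).
  move=> kN; have adm : admissible D (fun n => pt n (k n) : cayley R G).
    apply: (@admissible_near _ _ _ x _ C); apply: filterS NC => n; apply: le_trans.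
    rewrite -pt0 ler_nat; apply: leq_trans (dist_vert _ _ (leq0n _)) _.
    by rewrite subn0.
  by exists (exist _ _ adm).
have [x' x'E] := mkpoint i iN; have [y' y'E] := mkpoint l lN.
have xx' : mdist a (cone_point x') <= eps.
  rewrite aE; apply: mdist_cone_le; apply: filterS i_le => n; apply: le_trans.
  rewrite x'E -pt0 ler_nat; apply: leq_trans (dist_vert _ _ (leq0n _)) _.
  by rewrite subn0.
have yy' : mdist b (cone_point y') <= eps.
  rewrite bE; apply: mdist_cone_le; apply: filterS i_le => n; apply: le_trans.
  rewrite y'E -ptN dist_sym ler_nat; apply: leq_trans (dist_vert _ _ (lN n)) _.
  by rewrite leq_subLR addnC -leq_subLR leq_maxr.
pose B n m j e := [/\ (i n <= j < l n)%N, (m.+1 * e <= 4 * (l n - i n))%N &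
  barrier (term x n) (term y n) (pt n j) m e].
have barP m : \forall n \near w, exists je : nat * nat, B n m je.1 je.2.
  have [F|] := in_ultra_setVsetC
      [set n | factorable (4 * (m.+1 * m)) ((term x' n)^-1 * term y' n)%g] (cone_filter_ultra D).
    exfalso; apply: nab; exists (cone_point x'), (cone_point y'); split => //.
    exact: factorable_finite_join_length F.
  apply: filterS => n /= nF; have [yE _ gs] := sP n.
  have iln : (i n <= l n <= size (s n))%N by rewrite il lN.
  have [F|[j [e bje]]] := @barrier_exists _ (term x n) (s n) m (i n) (l n) gs iln.
    by exfalso; apply: nF; rewrite x'E y'E.
  by exists (j, e); rewrite /B yE.
have [m [m_oo mP]] := near_diagonal barP.
have [je jeP] := @near_choice _ _ D (nat * nat)%type (0%N, 0%N)
    (fun n je => B n (m n) je.1 je.2) mP.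
have [z zE] := mkpoint (fun n => minn (je n).1 (N n)) (fun n => geq_minr _ _).
have zP : \forall n \near w, [/\ B n (m n) (je n).1 (je n).2 & term z n = pt n (je n).1].
  apply: filterS jeP => n Bn; split => //; rewrite zE; congr pt.
  by apply/minn_idPl; case: Bn => /andP[_ /ltnW jl] _ _; exact: leq_trans (lN n).
have far : \forall n \near w,
    (eps / 2) * d n <= dist (term x n) (term z n) /\
    (eps / 2) * d n <= dist (term y n) (term z n).
  near=> n; have [[/andP[ij jl] _ _] zn] :
    [/\ B n (m n) (je n).1 (je n).2 & term z n = pt n (je n).1] by near: n.
  have jN := leq_trans jl (lN n).
  have dxy : cayley_dist (term x n) (term y n) = N n by have [_ <- _] := sP n.
  have dxz := dist_vert (term x n) (s n) (leq0n (je n).1).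
  have dzy := dist_vert (term x n) (s n) (ltnW jN).
  rewrite -/(pt n 0) -/(pt n (je n).1) -/(pt n (N n)) pt0 ptN -zn in dxz dzy.
  have tri := cayley_dist_triangle (term z n) (term x n) (term y n).
  have iE : i n = Num.truncn (eps * d n).
    move: ij jl; rewrite /l /i; lia.
  have ti : (eps / 2) * d n <= (i n)%:R.
    rewrite iE; have := truncnS_gt (eps * d n); rewrite -natr1.
    have : 2 <= eps * d n; last by lra.
    rewrite mulrC -ler_pdivrMr //; near: n; exact: scaling_ge.
  by split; apply: (le_trans ti); rewrite ler_nat; move: jl; rewrite /l; 
    rewrite 1?[cayley_dist (term y n) _]cayley_dist_sym; lia.
apply: (nsep (cone_point z)); apply: (@barrier_separates x y z m (fun n => (je n).2)) => //.
- move=> e e0; pose K := Num.truncn (4 * C / e).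
  near=> n; have [[_ me _] _] :
    [/\ B n (m n) (je n).1 (je n).2 & term z n = pt n (je n).1] by near: n.
  have Nn : (N n)%:R <= C * d n by near: n.
  have Km : (K <= m n)%N by near: n; exact: m_oo.
  have K1 : 4 * C / e < (m n).+1%:R.
    by apply: lt_le_trans (truncnS_gt _) _; rewrite ler_nat.
  have d0n : 0 < d n by near: n.
  have mS : (0 : R) < (m n).+1%:R by rewrite ltr0n.
  have meN : ((m n).+1 * (je n).2 <= 4 * N n)%N.
    by apply: leq_trans me _; rewrite leq_mul2l (leq_trans (leq_subr _ _)).
  rewrite -(ler_pM2l mS); apply: (@le_trans _ _ (4 * (C * d n))).
    apply: (@le_trans _ _ (4 * N n)%:R); first by rewrite -natrM ler_nat.
    by rewrite natrM ler_pM2l.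
  rewrite ltr_pdivrMr // in K1; rewrite !mulrA ler_pM2r //; exact: ltW.
- by apply: filterS zP => n [[_ _ bn] ->].
- move=> xz; have : eps / 2 <= mdist (cone_point x) (cone_point z).
    by apply: mdist_cone_ge; apply: filterS far => n [].
  by rewrite xz mdistxx; lra.
- move=> yz; have : eps / 2 <= mdist (cone_point y) (cone_point z).
    by apply: mdist_cone_ge; apply: filterS far => n [].
  by rewrite yz mdistxx; lra.
Unshelve. all: by end_near. Qed.

End CutPoints.

Local Open Scope ring_scope.

Theorem theorem4p6 (R : realType) (G : sgraph) (Gconn : connected_graph G)
    (D : cone_data R (cayley R G)) (a b : acone D) :
  (forall c : acone D, ~ separates c a b) <->
  (forall eps : R, 0 < eps -> exists a' b' : acone D,
     [/\ mdist a a' <= eps, mdist b b' <= eps & finite_join_length a' b']).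
Proof.
split; first exact: not_separated_approximable.
by move=> ab c; exact: approximable_not_separated.
Qed.
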